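(* Let $\mathfrak{g}$ be a finite-dimensional complex semisimple Lie algebra, let $q$ be a primitive root of unity of order $l$, and let $U_q(\mathfrak{g})$ be the corresponding quantum group at a root of unity (the finite-dimensional version). For any twist $J$ of $U_q(\mathfrak{g})$ and any grouplike element $g$ of $U_q(\mathfrak{g})^J$, the order of $g$ divides $l$.
   Context: All Hopf algebras are over $\mathbb{C}$. $U_q(\mathfrak{g})$ denotes the finite-dimensional version of the quantum group attached to $\mathfrak{g}$ at the root of unity $q$ of order $l$. It is the finite-dimensional pointed Hopf algebra generated by $e_i,f_i,K_i^{\pm1}$ with the usual relations and additional relations that make it finite-dimensional. With Cartan matrix $(a_{ij})$, symmetrizing integers $d_i$ and $q_i=q^{d_i}$, the usual relations are $K_iK_j=K_jK_i$, $K_ie_jK_i^{-1}=q_i^{a_{ij}}e_j$, $K_if_jK_i^{-1}=q_i^{-a_{ij}}f_j$, $[e_i,f_j]=\delta_{ij}\frac{K_i-K_i^{-1}}{q_i-q_i^{-1}}$ and the quantum Serre relations. The additional relations are $K_i^l=1$ and the vanishing of suitable powers of the positive and negative root vectors (for example, the $l$-th powers, including $e_i^l=f_i^l=0$, when $l$ is odd and, if $\mathfrak{g}$ has a $G_2$ component, prime to $3$). The coproduct is $\Delta(K_i)=K_i\otimes K_i$, $\Delta(e_i)=e_i\otimes 1+K_i\otimes e_i$, $\Delta(f_i)=f_i\otimes K_i^{-1}+1\otimes f_i$. A Hopf algebra is pointed if all its irreducible corepresentations are 1-dimensional. A twist for a Hopf algebra $H$ with coproduct $\Delta$, counit $\varepsilon$,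 antipode $S$ and multiplication $m$ is an invertible $J\in H\otimes H$ with $(\Delta\otimes \mathrm{Id})(J)(J\otimes 1)=(\mathrm{Id}\otimes \Delta)(J)(1\otimes J)$ and $(\varepsilon\otimes \mathrm{Id})(J)=(\mathrm{Id}\otimes \varepsilon)(J)=1$. The twisted Hopf algebra $H^J$ equals $H$ as an algebra, with coproduct $\Delta^J(x)=J^{-1}\Delta(x)J$ and antipode $S^J(x)=Q^{-1}S(x)Q$, where $Q=m\circ(S\otimes \mathrm{Id})(J)$. An element $g\in H^J$ is grouplike if $g\neq 0$ and $\Delta^J(g)=g\otimes g$. *)

(* Defs.v *)
From HB Require Import structures.
From mathcomp Require Import all_boot all_order all_algebra all_field.
From mathcomp Require Import complex reals.

Set Implicit Arguments.
Unset Strict Implicit.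
Unset Printing Implicit Defensive.

Import GRing.Theory.

Local Open Scope ring_scope.

(** * Tensor products of finite-dimensional spaces and algebras

    [tensor U V] is the space of matrices of coordinates with respect to the
    products of the vectors of [vbasis {:U}] and [vbasis {:V}]; [tlift f] is the
    linear map on [tensor U V] induced by a bilinear map [f] (lemma
    [tlift_tens]). *)

Section Tensor.
Variable F : fieldType.
Implicit Types U V W : vectType F.

Definition tensor U V : Type := 'M[F]_(\dim {:U}, \dim {:V}).

HB.instance Definition _ U V :=
  Vector.copy (tensor U V) 'M[F]_(\dim {:U}, \dim {:V}).

Definition tens U V (u : U) (v : V) : tensor U V :=
  \matrix_(i, j) (coord (vbasis {:U}) i u * coord (vbasis {:V}) j v).

Definition tlift U V W (f : U -> V -> W) (M : tensor U V) : W :=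
  \sum_i \sum_j M i j *: f (vbasis {:U})`_i (vbasis {:V})`_j.

Definition bilinear_map U V W (f : U -> V -> W) :=
  (forall v, linear (f^~ v)) /\ (forall u, linear (f u)).

Definition tmap U V U' V' (f : U -> U') (g : V -> V') :
    tensor U V -> tensor U' V' :=
  tlift (fun u v => tens (f u) (g v)).

Definition tassoc U V W : tensor (tensor U V) W -> tensor U (tensor V W) :=
  tlift (fun t w => tlift (fun u v => tens u (tens v w)) t).

Lemma tens_bilinear U V : bilinear_map (@tens U V).
Proof.
split=> [v | u] a x y; apply/matrixP => i j; rewrite !mxE linearP /=.
  by rewrite mulrDl mulrA.
by rewrite mulrDr !mulrA (mulrC a).
Qed.

Lemma tlift_linear U V W (f : U -> V -> W) : linear (tlift f).
Proof.
move=> a M N; rewrite /tlift scaler_sumr -big_split /=.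
apply: eq_bigr => i _; rewrite scaler_sumr -big_split /=.
by apply: eq_bigr => j _; rewrite !mxE scalerDl scalerA.
Qed.

HB.instance Definition _ U V W (f : U -> V -> W) :=
  GRing.isLinear.Build F (tensor U V) W *:%R (tlift f) (tlift_linear f).

Lemma sum_linear U W (f : U -> W) (I : finType) (c : I -> F) (x : I -> U) :
  linear f -> f (\sum_i c i *: x i) = \sum_i c i *: f (x i).
Proof.
move=> lf; have f0 : f 0 = 0.
  by have := lf (-1) 0 0; rewrite scaler0 addr0 scaleN1r addNr.
by elim/big_rec2: _ => // i y z _ <-; rewrite lf.
Qed.

Lemma vbasis_coord U (u : U) :
  u = \sum_i coord (vbasis {:U}) i u *: (vbasis {:U})`_i.
Proof. exact: coord_vbasis (memvf u). Qed.

Lemma tlift_tens U V W (f : U -> V -> W) u v :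
  bilinear_map f -> tlift f (tens u v) = f u v.
Proof.
case=> fl fr; rewrite [u in RHS]vbasis_coord (sum_linear _ _ (fl v)) /tlift.
apply: eq_bigr => i _; rewrite [v in RHS]vbasis_coord.
rewrite (sum_linear _ _ (fr _)) scaler_sumr.
by apply: eq_bigr => j _; rewrite mxE scalerA.
Qed.

Lemma tens_basis U V (M : tensor U V) :
  M = \sum_i \sum_j M i j *: tens (vbasis {:U})`_i (vbasis {:V})`_j.
Proof.
have fb W : free (vbasis {:W}) by exact: basis_free (vbasisP _).
rewrite [LHS]matrix_sum_delta; apply: eq_bigr => i _; apply: eq_bigr => j _.
congr (_ *: _); apply/matrixP=> i' j'; rewrite !mxE !coord_free //.
by rewrite (eq_sym i') (eq_sym j') -natrM mulnb (eq_sym i) (eq_sym j).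
Qed.

Lemma tensor_ext U V W (f g : tensor U V -> W) :
  linear f -> linear g -> (forall u v, f (tens u v) = g (tens u v)) -> f =1 g.
Proof.
move=> lf lg fg M; rewrite (tens_basis M).
rewrite !pair_bigA /= !(sum_linear (I := ('I_(\dim {:U}) * 'I_(\dim {:V}))%type)
  (fun p => M p.1 p.2) (fun p => tens (vbasis {:U})`_p.1 (vbasis {:V})`_p.2)) //.
by apply: eq_bigr => p _; rewrite fg.
Qed.

End Tensor.

Section TensorAlgebra.
Variable F : fieldType.
Implicit Types A B : falgType F.

Definition tmul A B (M N : tensor A B) : tensor A B :=
  tlift (fun a b => tlift (fun a' b' => tens (a * a') (b * b')) N) M.

Variables A B : falgType F.
Implicit Types M N P : tensor A B.

Let tl (b : B) : linear ((@tens F A B)^~ b) := (tens_bilinear A B).1 b.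
Let tr (a : A) : linear (@tens F A B a) := (tens_bilinear A B).2 a.

Lemma tmul_linear_l N : linear ((@tmul A B)^~ N).
Proof. exact: tlift_linear. Qed.

Lemma tmul_linear_r M : linear (tmul M).
Proof.
move=> c N P; rewrite /tmul {1 3 5}/tlift scaler_sumr -big_split /=.
apply: eq_bigr => i _; rewrite scaler_sumr -big_split /=.
apply: eq_bigr => j _; rewrite linearP scalerDr !scalerA.
by rewrite (mulrC c).
Qed.

Lemma tmul_tens (a a' : A) (b b' : B) :
  tmul (tens a b) (tens a' b') = tens (a * a') (b * b').
Proof.
have bil (c : A) (e : B) :
    bilinear_map (fun c' e' => tens (c * c') (e * e')).
  split=> [e' | c'] k x y; rewrite mulrDr -scalerAr; [exact: tl|exact: tr].
rewrite /tmul tlift_tens ?tlift_tens //; split=> [e | c] k x y.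
  rewrite /tlift scaler_sumr -big_split; apply: eq_bigr => i _ /=.
  rewrite scaler_sumr -big_split; apply: eq_bigr => j _ /=.
  by rewrite mulrDl -scalerAl tl scalerDr !scalerA (mulrC k).
rewrite /tlift scaler_sumr -big_split; apply: eq_bigr => i _ /=.
rewrite scaler_sumr -big_split; apply: eq_bigr => j _ /=.
by rewrite mulrDl -scalerAl tr scalerDr !scalerA (mulrC k).
Qed.

Lemma tmulA : associative (@tmul A B).
Proof.
move=> M N P; move: M.
apply: tensor_ext => [||a b]; first exact: tmul_linear_l.
  by move=> c M M'; rewrite !tmul_linear_l.
move: N; apply: tensor_ext => [||a' b'].
- by move=> c N N'; rewrite tmul_linear_l tmul_linear_r.
- by move=> c N N'; rewrite tmul_linear_r tmul_linear_l.
move: P; apply: tensor_ext => [||a2 b2].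
- by move=> c N N'; rewrite !tmul_linear_r.
- exact: tmul_linear_r.
by rewrite !tmul_tens !mulrA.
Qed.

Definition tone : tensor A B := tens 1 1.

Lemma tmul1l : left_id tone (@tmul A B).
Proof.
apply: tensor_ext => [||a b]; [exact: tmul_linear_r | by [] |].
by rewrite tmul_tens !mul1r.
Qed.

Lemma tmul1r : right_id tone (@tmul A B).
Proof.
apply: tensor_ext => [||a b]; [exact: tmul_linear_l | by [] |].
by rewrite tmul_tens !mulr1.
Qed.

Lemma tmulDl : left_distributive (@tmul A B) +%R.
Proof. by move=> M N P; have := tmul_linear_l P 1 M N; rewrite !scale1r. Qed.

Lemma tmulDr : right_distributive (@tmul A B) +%R.
Proof. by move=> M N P; have := tmul_linear_r M 1 N P; rewrite !scale1r. Qed.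

Lemma tone_neq0 : tone != 0.
Proof.
have coord_neq0 (D : falgType F) : exists i, coord (vbasis {:D}) i (1 : D) != 0.
  case: (pickP (fun i => coord (vbasis {:D}) i (1 : D) != 0)) => [i ci | c0].
    by exists i.
  case/eqP: (oner_neq0 D); rewrite [LHS]vbasis_coord big1 // => i _.
  by have /negbFE/eqP -> := c0 i; rewrite scale0r.
have [i ai] := coord_neq0 A; have [j bj] := coord_neq0 B.
apply/eqP => /matrixP/(_ i j)/eqP; rewrite !mxE mulf_eq0.
by rewrite (negPf ai) (negPf bj).
Qed.

HB.instance Definition _ := GRing.Zmodule_isNzRing.Build (tensor A B)
  tmulA tmul1l tmul1r tmulDl tmulDr tone_neq0.

Lemma tmulZl (c : F) M N : c *: (M * N) = (c *: M) * N.
Proof.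
have E : (c *: M + 0) * N = c *: (M * N) + 0 * N by exact: tmul_linear_l.
by rewrite -[c *: M]addr0 E mul0r addr0.
Qed.

HB.instance Definition _ :=
  GRing.Lmodule_isLalgebra.Build F (tensor A B) tmulZl.

Lemma tmulZr (c : F) M N : c *: (M * N) = M * (c *: N).
Proof.
have E : M * (c *: N + 0) = c *: (M * N) + M * 0 by exact: tmul_linear_r.
by rewrite -[c *: N]addr0 E mulr0 addr0.
Qed.

HB.instance Definition _ := GRing.Lalgebra_isAlgebra.Build F (tensor A B) tmulZr.
HB.instance Definition _ := Algebra_isFalgebra.Build F (tensor A B).

Lemma tensM (a a' : A) (b b' : B) :
  tens a b * tens a' b' = tens (a * a') (b * b').
Proof. exact: tmul_tens. Qed.

End TensorAlgebra.

(** * Finite-dimensional Hopf algebras, twists *)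

Record hopfAlgebra (F : fieldType) := HopfAlgebra {
  hopf_alg :> falgType F;
  coproduct : {lrmorphism hopf_alg -> tensor hopf_alg hopf_alg};
  counit : {lrmorphism hopf_alg -> F^o};
  antipode : {linear hopf_alg -> hopf_alg};
  coproductA : forall x,
    tassoc (tmap coproduct idfun (coproduct x))
      = tmap idfun coproduct (coproduct x);
  counit_l : forall x, tlift (fun a b => counit a *: b) (coproduct x) = x;
  counit_r : forall x, tlift (fun a b => counit b *: a) (coproduct x) = x;
  antipode_l : forall x,
    tlift (fun a b => antipode a * b) (coproduct x) = (counit x)%:A;
  antipode_r : forall x,
    tlift (fun a b => a * antipode b) (coproduct x) = (counit x)%:A
}.

Section Twist.
Variables (F : fieldType) (H : hopfAlgebra F).
Implicit Types J : tensor H H.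

Definition is_twist J :=
  [/\ J \is a GRing.unit,
      tassoc (tmap (coproduct H) idfun J * tens J (1 : H))
        = tmap idfun (coproduct H) J * tens (1 : H) J,
      tlift (fun a b => counit H a *: b) J = 1
    & tlift (fun a b => counit H b *: a) J = 1].

Definition twisted_coproduct J (x : H) : tensor H H :=
  J^-1 * coproduct H x * J.

Definition grouplike_twisted J (g : H) :=
  g != 0 /\ twisted_coproduct J g = tens g g.

End Twist.

Definition has_order (A : nzRingType) (g : A) (m : nat) :=
  [/\ (0 < m)%N, g ^+ m = 1
    & forall k, (0 < k)%N -> g ^+ k = 1 -> (m <= k)%N].

(** * Finite-dimensional semisimple Lie algebras and their Cartan matrices *)

Record lieAlgebra (F : fieldType) := LieAlgebra {
  lie_space :> vectType F;
  bracket : lie_space -> lie_space -> lie_space;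
  bracket_bilinear : bilinear_map bracket;
  bracket_alt : forall x, bracket x x = 0;
  bracket_jacobi : forall x y z,
    bracket x (bracket y z) + bracket y (bracket z x)
      + bracket z (bracket x y) = 0
}.

Section Lie.
Variables (F : fieldType) (g : lieAlgebra F).
Implicit Types (U V I h : {vspace g}).

Definition bracketv U V : {vspace g} :=
  <<[seq bracket u v | u <- vbasis U, v <- vbasis V]>>%VS.

Definition lie_ideal I := (bracketv {:g} I <= I)%VS.

Definition lie_solvable I :=
  exists k, iter k (fun D => bracketv D D) I = 0%VS.

Definition lie_semisimple :=
  forall I, lie_ideal I -> lie_solvable I -> I = 0%VS.

Definition lie_nilpotent h := exists k, iter k (bracketv h) h = 0%VS.

Definition cartan_subalgebra h :=
  [/\ (bracketv h h <= h)%VS, lie_nilpotent h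
    & forall x, (forall y, y \in h -> bracket x y \in h) -> x \in h].

(* Weights of [h] are given by linear forms on [g], of which only the
   restriction to [h] is used. *)
Definition root_vector h (a : {linear g -> F^o}) (x : g) :=
  forall t, t \in h -> bracket t x = a t *: x.

Definition is_root h (a : {linear g -> F^o}) :=
  (exists2 t, t \in h & a t != 0) /\ (exists2 x, x != 0 & root_vector h a x).

Definition is_root_base h n (a : 'I_n -> {linear g -> F^o}) :=
  [/\ forall i, is_root h (a i),
      forall c : 'I_n -> F,
        (forall t, t \in h -> \sum_i c i * a i t = 0) -> forall i, c i = 0
    & forall b, is_root h b -> exists c : 'I_n -> nat,
        (forall t, t \in h -> b t = \sum_i a i t *+ c i) \/
        (forall t, t \in h -> b t = - (\sum_i a i t *+ c i))].

Definition is_coroot h (a : {linear g -> F^o}) (t : g) :=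
  [/\ t \in h, a t = 2%:R
    & exists x y, [/\ root_vector h a x, root_vector h (\- a) y
                    & t = bracket x y]].

(* [A i j] is the value of the [j]-th simple root on the [i]-th simple coroot. *)
Definition is_cartan_matrix n (A : 'M[int]_n) :=
  exists (h : {vspace g}) (a : 'I_n -> {linear g -> F^o}) (t : 'I_n -> g),
    [/\ cartan_subalgebra h, is_root_base h a,
        forall i, is_coroot h (a i) (t i)
      & forall i j, a j (t i) = (A i j)%:~R].

End Lie.

(** * Symmetrizing integers and the Weyl group of a Cartan matrix *)

Section CartanMatrix.
Variables (n : nat) (A : 'M[int]_n).

Definition symmetrizes (d : 'I_n -> nat) :=
  (forall i, (0 < d i)%N) /\
  (forall i j, (d i)%:Z * A i j = (d j)%:Z * A j i).

(* The least one is relatively prime on each component of the Dynkin diagram: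
   its entries are 1, 2 or 3, and it is 1 on the short roots. *)
Definition symmetrizing_integers (d : 'I_n -> nat) :=
  symmetrizes d /\ forall d', symmetrizes d' -> forall i, (d i <= d' i)%N.

(* Elements of the root lattice are rows of coordinates on the simple roots. *)
Definition simple_reflection (i : 'I_n) (v : 'rV[int]_n) : 'rV[int]_n :=
  v - (\sum_j A i j * v 0 j) *: delta_mx 0 i.

Definition weyl_act (w : seq 'I_n) (v : 'rV[int]_n) := foldr simple_reflection v w.

Definition reduced_word (w : seq 'I_n) :=
  forall w', weyl_act w' =1 weyl_act w -> (size w <= size w')%N.

Definition longest_word (w : seq 'I_n) :=
  reduced_word w /\ forall w', reduced_word w' -> (size w' <= size w)%N.

End CartanMatrix.

(** * Symmetric [q]-integers, [q]-factorials and [q]-binomials *)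

Section QNumbers.
Variables (F : fieldType) (q : F).

Definition qint (m : nat) : F := \sum_(s < m) q ^ ((m%:Z - 1) - (s%:Z) *+ 2).

Definition qfact (m : nat) : F := \prod_(s < m) qint s.+1.

(* The Pascal rule evaluates the Laurent polynomial also where [qfact]
   vanishes. *)
Fixpoint qbinom (m k : nat) : F :=
  match m, k with
  | _, 0 => 1
  | 0, _.+1 => 0
  | m'.+1, k'.+1 => q ^+ k * qbinom m' k + q ^ (k'%:Z - m'%:Z) * qbinom m' k'
  end.

End QNumbers.

(** * Quantum groups at roots of unity *)

Record uq_gens (n : nat) (B : Type) := UqGens {
  gen_e : 'I_n -> B;
  gen_f : 'I_n -> B;
  gen_K : 'I_n -> B;
  gen_Kinv : 'I_n -> B
}.

Definition map_gens n B B' (phi : B -> B') (x : uq_gens n B) : uq_gens n B' :=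
  UqGens (phi \o gen_e x) (phi \o gen_f x) (phi \o gen_K x) (phi \o gen_Kinv x).

Definition eq_gens n B (x y : uq_gens n B) :=
  [/\ gen_e x =1 gen_e y, gen_f x =1 gen_f y,
      gen_K x =1 gen_K y & gen_Kinv x =1 gen_Kinv y].

(* The inverses of q_i - q_i^-1 (in [rel_ef]) and of the q-factorials [k]! with
   k <= - A i j (in [braid]) carry no side condition: where such a scalar is 0,
   its inverse is 0 by convention and the usual relations or the root vectors
   have no standard meaning. This only occurs when l divides some 2 d_i, or when
   l = 4 and there is a G2 component. *)
Section QuantumGroup.
Variables (F : fieldType) (n : nat) (A : 'M[int]_n) (d : 'I_n -> nat) (q : F).

Definition q_ (i : 'I_n) : F := q ^+ d i.

Definition serre_sum (B : algType F) (u : 'I_n -> B) (i j : 'I_n) : B :=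
  let m := absz (1 - A i j) in
  \sum_(k < m.+1) ((-1) ^+ k * qbinom (q_ i) m k) *:
     (u i ^+ (m - k) * u j * u i ^+ k).

Record uq_usual_relations (B : algType F) (x : uq_gens n B) : Prop := {
  rel_KKinv : forall i, gen_K x i * gen_Kinv x i = 1;
  rel_KinvK : forall i, gen_Kinv x i * gen_K x i = 1;
  rel_KK : forall i j, gen_K x i * gen_K x j = gen_K x j * gen_K x i;
  rel_Ke : forall i j,
    gen_K x i * gen_e x j * gen_Kinv x i = q_ i ^ A i j *: gen_e x j;
  rel_Kf : forall i j,
    gen_K x i * gen_f x j * gen_Kinv x i = q_ i ^ (- A i j) *: gen_f x j;
  rel_ef : forall i j,
    gen_e x i * gen_f x j - gen_f x j * gen_e x i =
      if i == j then (q_ i - (q_ i)^-1)^-1 *: (gen_K x i - gen_Kinv x i) else 0;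
  rel_serre_e : forall i j, i != j -> serre_sum (gen_e x) i j = 0;
  rel_serre_f : forall i j, i != j -> serre_sum (gen_f x) i j = 0
}.

Definition Kpow (B : algType F) (x : uq_gens n B) (i : 'I_n) (z : int) : B :=
  if 0 <= z then gen_K x i ^+ absz z else gen_Kinv x i ^+ absz z.

(* The values on the generators of Lusztig's automorphism [T_i] (the one
   denoted T''_{i,1} in his book), written in terms of the generators [x]; the
   divided powers u^(k) are u^k / [k]!. *)
Definition braid (B : algType F) (x : uq_gens n B) (i : 'I_n) : uq_gens n B :=
  let dp k := (qfact (q_ i) k)^-1 in
  {| gen_e := fun j =>
       if j == i then - (gen_f x i * gen_K x i) else
       let r := absz (A i j) in
       \sum_(k < r.+1) ((-1) ^+ k * q_ i ^- k * dp (r - k)%N * dp k) *: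
          (gen_e x i ^+ (r - k) * gen_e x j * gen_e x i ^+ k);
     gen_f := fun j =>
       if j == i then - (gen_Kinv x i * gen_e x i) else
       let r := absz (A i j) in
       \sum_(k < r.+1) ((-1) ^+ k * q_ i ^+ k * dp k * dp (r - k)%N) *:
          (gen_f x i ^+ k * gen_f x j * gen_f x i ^+ (r - k));
     gen_K := fun j => gen_K x j * Kpow x i (- A i j);
     gen_Kinv := fun j => Kpow x i (A i j) * gen_Kinv x j |}.

(* As [braid x i] substitutes the [T_i]-images of the generators for the
   generators, the generators of [braid_word x [:: i1; ...; ik]] are the images
   of those of [x] under T_i1 ... T_ik, in this order of composition. *)
Definition braid_word (B : algType F) (x : uq_gens n B) (w : seq 'I_n) :=
  foldl (@braid B) x w.

(* For the reduced word [i1; ...; iN] of the longest element, the root vectors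
   of the k-th positive root s_i1 ... s_i(k-1) (alpha_ik) are the images of
   e_ik and f_ik under T_i1 ... T_i(k-1). Their exponent is the order of
   q^(2 d_ik) when q has order l, hence l if l is odd and prime to d_ik. *)
Definition uq_finite_relations (l : nat) (w0 : seq 'I_n) (B : algType F)
    (x : uq_gens n B) : Prop :=
  (forall i, gen_K x i ^+ l = 1) /\
  (forall w i w', w0 = w ++ i :: w' ->
     let N := (l %/ gcdn l (2 * d i))%N in
     gen_e (braid_word x w) i ^+ N = 0 /\ gen_f (braid_word x w) i ^+ N = 0).

Definition uq_relations l w0 (B : algType F) (x : uq_gens n B) :=
  uq_usual_relations x /\ uq_finite_relations l w0 x.

(* [B] is the algebra presented by the generators [x] and the relations. *)
Definition uq_presented l w0 (B : algType F) (x : uq_gens n B) :=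
  uq_relations l w0 x /\
  forall (B' : algType F) (y : uq_gens n B'), uq_relations l w0 y ->
    exists phi : {lrmorphism B -> B'},
      eq_gens (map_gens phi x) y /\
      forall psi : {lrmorphism B -> B'}, eq_gens (map_gens psi x) y ->
        psi =1 phi.

(* Finite-dimensionality is part of [hopfAlgebra]; the counit and the antipode
   are determined by the coproduct; pointedness follows from the generation by
   grouplike and skew-primitive elements. *)
Definition is_uq l w0 (H : hopfAlgebra F) :=
  exists x : uq_gens n H,
    [/\ uq_presented l w0 x,
        forall i, coproduct H (gen_K x i) = tens (gen_K x i) (gen_K x i),
        forall i, coproduct H (gen_e x i)
          = tens (gen_e x i) 1 + tens (gen_K x i) (gen_e x i)
      & forall i, coproduct H (gen_f x i)
          = tens (gen_f x i) (gen_Kinv x i) + tens 1 (gen_f x i)].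

End QuantumGroup.

(* Main.v *)
Require Import Defs.
From HB Require Import structures.
From mathcomp Require Import all_boot all_order all_algebra all_field.
From mathcomp Require Import boolp complex reals.

Set Implicit Arguments.
Unset Strict Implicit.
Unset Printing Implicit Defensive.

Import GRing.Theory Num.Theory.

Local Open Scope ring_scope.

(** The order of a grouplike element [g] of [H^J] is controlled by the Drinfeld
    double. Twisting does not change the braided category of Yetter-Drinfeld
    modules, so a module that is simple to describe over [H^J] can be studied
    over [H] itself, whose coradical is spanned by grouplike elements of order
    dividing [l].

    The module is the one induced from the character [g] of the dual of [H^J].
    As an [H]-module it is [H]; its coaction comes from a half-braiding [c] that
    is left [H]-linear, natural in the other tensor factor and determined by
    [c J = J * (g (x) 1)] ([half_braiding_gen]). The cocycle equation of [J]
    gives the hexagon for [c], that is, coassociativity ([coactionA]).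

    On such a module the Drinfeld element acts by [T_g m = S(m_(-1)) m_(0)], and
    [T_g (h m) = S^2(h) T_g m]. The map [S^2] has order dividing [l] for the
    quantum group, since it maps [e_i] to [K_i^-1 e_i K_i]. So [T_g ^ l] is
    right multiplication by the element [Z_g] to which it maps [1], and this
    element is unipotent ([drinfeld_power_unipotent]): in each proper quotient
    of [H] by a submodule there is a vector whose coaction is given by a
    grouplike element [w] of [H], because [H] is generated by grouplike and
    skew-primitive elements. On this vector [T_g] acts as [w^-1], hence
    [T_g ^ l] as the identity, and one goes on with the submodule that the
    vector generates.

    With [Q = S(J') J''] for [J = J' (x) J''], applying [T_g] to the equation
    for [c J] gives [S(Q) T_g(1) = S(g) Q = Q g^-1] ([drinfeld1]). Comparing with
    the case of the grouplike element [1] gives [T_g(1) = T_1(1) g^-1] and then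
    [Z_g = Z_1 g^-l], with [Z_1] and [g] commuting. Both [Z_g] and [Z_1] are
    unipotent, so [g^-l] is, and a unipotent grouplike element is [1] in
    characteristic 0 ([unipotent_twisted_grouplike]).

    The universal property of the presented algebra enters only once, applied to
    the subalgebra that the generators generate: it shows that this subalgebra is
    everything ([uq_generated]). *)

(** * Tensor calculus *)

Section TensorCalculus.
Variable F : fieldType.
Implicit Types U V W : vectType F.

Lemma tensPl U V (w : V) k (u v : U) :
  tens (k *: u + v) w = k *: tens u w + tens v w.
Proof. exact: (tens_bilinear U V).1. Qed.

Lemma tensPr U V (w : U) k (u v : V) :
  tens w (k *: u + v) = k *: tens w u + tens w v.
Proof. exact: (tens_bilinear U V).2. Qed.

Lemma linear_scale U V (f : U -> V) k u : linear f -> f (k *: u) = k *: f u.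
Proof.
move=> lf; have f0 : f 0 = 0.
  by have := lf (-1) 0 0; rewrite scaler0 addr0 scaleN1r addNr.
by have := lf k u 0; rewrite f0 !addr0.
Qed.

Lemma tensZl U V k (u : U) (v : V) : tens (k *: u) v = k *: tens u v.
Proof. exact: (linear_scale k u ((tens_bilinear U V).1 v)). Qed.

Lemma tensZr U V k (u : U) (v : V) : tens u (k *: v) = k *: tens u v.
Proof. exact: (linear_scale k v ((tens_bilinear U V).2 u)). Qed.

Lemma mulrPl (A : algType F) k (x y z : A) :
  (k *: x + y) * z = k *: (x * z) + y * z.
Proof. by rewrite mulrDl scalerAl. Qed.

Lemma mulrPr (A : algType F) k (x y z : A) :
  z * (k *: x + y) = k *: (z * x) + z * y.
Proof. by rewrite mulrDr scalerAr. Qed.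

Lemma scalerPl (V : lmodType F) k (a b : F^o) (v : V) :
  (k *: a + b) *: v = k *: (a *: v) + b *: v.
Proof. by rewrite scalerDl scalerA. Qed.

Lemma scalerPr (V : lmodType F) k (a : F) (u v : V) :
  a *: (k *: u + v) = k *: (a *: u) + a *: v.
Proof. by rewrite scalerDr !scalerA mulrC. Qed.

HB.instance Definition _ U V U' V' (f : U -> U') (g : V -> V') :=
  GRing.isLinear.Build F (tensor U V) (tensor U' V') *:%R (tmap f g)
    (tlift_linear _).

HB.instance Definition _ U V W :=
  GRing.isLinear.Build F (tensor (tensor U V) W) (tensor U (tensor V W)) *:%R
    (@tassoc F U V W) (tlift_linear _).

Lemma tlift_fun U V W (f g h : U -> V -> W) k M :
    (forall u v, f u v = k *: g u v + h u v) ->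
  tlift f M = k *: tlift g M + tlift h M.
Proof.
move=> fE; rewrite /tlift scaler_sumr -big_split; apply: eq_bigr => i _ /=.
rewrite scaler_sumr -big_split; apply: eq_bigr => j _ /=.
by rewrite fE scalerDr !scalerA mulrC.
Qed.

Lemma tlift_comp U V W W' (f : U -> V -> W) (h : W -> W') M :
  linear h -> h (tlift f M) = tlift (fun u v => h (f u v)) M.
Proof.
move=> lh; rewrite /tlift !pair_bigA.
by rewrite (sum_linear (fun p => M p.1 p.2)
             (fun p => f (vbasis {:U})`_p.1 (vbasis {:V})`_p.2) lh).
Qed.

End TensorCalculus.

(** Linearity of compound expressions: a combination [k *: x + y] is pushed
    outwards until it is at the head. *)
Ltac lin :=
  let k := fresh "k" in let x := fresh "x" in let y := fresh "y" in
  rewrite /= ?/comp /=; move=> k x y /=;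
  repeat first
   [ match goal with |- (_ *: _ + _)%R = _ => reflexivity end
   | rewrite tensPl | rewrite tensPr | rewrite mulrPl | rewrite mulrPr
   | rewrite scalerPl | rewrite scalerPr
   | match goal with |- tlift _ _ = _ => apply: tlift_fun => ? ? /= end
   | match goal with lf : linear ?f |- context [?f (_ *: _ + _)] => rewrite lf end
   | rewrite linearP /= ];
  try reflexivity.
Ltac bil := split=> ?; lin.

Section TensorMaps.
Variable F : fieldType.
Implicit Types U V W : vectType F.

Lemma tmap_tens U V U' V' (f : {linear U -> U'}) (g : {linear V -> V'}) u v :
  tmap f g (tens u v) = tens (f u) (g v).
Proof. by rewrite /tmap tlift_tens //; bil. Qed.

Lemma tassoc_tens U V W (u : U) (v : V) (w : W) :
  tassoc (tens (tens u v) w) = tens u (tens v w).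
Proof. by rewrite /tassoc !tlift_tens //; bil. Qed.

(** Multilinear identities on tensors are reduced to pure tensors, one factor at
    a time; all later computations with coproducts follow this pattern. *)
Lemma tmap_mul (A B A' B' : falgType F) (f : {lrmorphism A -> A'})
    (g : {lrmorphism B -> B'}) (X Y : tensor A B) :
  tmap f g (X * Y) = tmap f g X * tmap f g Y.
Proof.
move: X; apply: tensor_ext; [lin | lin | move=> a b].
move: Y; apply: tensor_ext; [lin | lin | move=> a' b'].
by rewrite tensM !tmap_tens tensM !rmorphM.
Qed.

Lemma tassoc_mul (A B C : falgType F) (X Y : tensor (tensor A B) C) :
  tassoc (X * Y) = tassoc X * tassoc Y.
Proof.
move: X; apply: tensor_ext; [lin | lin | move=> X c].
move: Y; apply: tensor_ext; [lin | lin | move=> Y c'].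
rewrite tensM.
move: X; apply: tensor_ext; [lin | lin | move=> a b].
move: Y; apply: tensor_ext; [lin | lin | move=> a' b'].
by rewrite tensM !tassoc_tens !tensM.
Qed.

Lemma tens11 (A B : falgType F) : tens (1 : A) (1 : B) = 1.
Proof. by []. Qed.

Definition lcontr U V (phi : U -> F^o) (X : tensor U V) : V :=
  tlift (fun u v => (phi u : F) *: v) X.

HB.instance Definition _ U V (phi : U -> F^o) :=
  GRing.isLinear.Build F (tensor U V) V *:%R (lcontr phi) (tlift_linear _).

Lemma lcontr_tens U V (phi : U -> F^o) (u : U) (v : V) :
  linear phi -> lcontr phi (tens u v) = (phi u : F) *: v.
Proof. by move=> lphi; rewrite /lcontr tlift_tens //; bil. Qed.

(** Expansion along a basis of the first factor: a tensor lies in [U (x) M] as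
    soon as all its contractions lie in [M]. *)
Lemma lcontr_coord U V (X : tensor U V) :
  X = \sum_(i < \dim {:U}) tens (vbasis {:U})`_i (lcontr (coord (vbasis {:U}) i) X).
Proof.
have lf : linear (fun X : tensor U V =>
    \sum_(i < \dim {:U}) tens (vbasis {:U})`_i (lcontr (coord (vbasis {:U}) i) X)).
  move=> k x y; rewrite scaler_sumr -big_split; apply: eq_bigr => i _ /=.
  by rewrite linearP tensPr.
move: X; apply: tensor_ext => // u v.
rewrite {1}[u]vbasis_coord (sum_linear _ _ (f := (@tens F U V)^~ v)); last by lin.
apply: eq_bigr => i _; rewrite lcontr_tens; last by lin.
by rewrite /= tensZr.
Qed.

End TensorMaps.

(** * The antipode *)

Section Hopf.
Variables (F : fieldType) (H : hopfAlgebra F).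

Local Notation D := (coproduct H).
Local Notation S := (antipode H).
Local Notation e := (counit H).

Lemma coproductM x y : D (x * y) = D x * D y. Proof. exact: rmorphM. Qed.
Lemma counitM x y : (e (x * y) : F) = (e x : F) * (e y : F).
Proof. exact: rmorphM. Qed.

(** Operations into the triple tensor product: the coproduct applied to the first
    or to the second factor, and the insertion of [1] as a third or as a first
    factor. In these terms the twist equation is
    [coproduct12 J * embed12 J = coproduct23 J * embed23 J]. *)
Definition coproduct12 (X : tensor H H) : tensor H (tensor H H) :=
  tassoc (tmap D idfun X).
Definition coproduct23 (X : tensor H H) : tensor H (tensor H H) :=
  tmap idfun D X.
Definition embed12 (X : tensor H H) : tensor H (tensor H H) :=
  tassoc (tens X (1 : H)).
Definition embed23 (X : tensor H H) : tensor H (tensor H H) :=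
  tens (1 : H) X.

Local Notation d1 := coproduct12.
Local Notation d2 := coproduct23.
Local Notation i12 := embed12.
Local Notation i23 := embed23.

Fact coproduct12_linear : linear d1.
Proof. by rewrite /d1; lin. Qed.
HB.instance Definition _ := GRing.isLinear.Build F _ _ *:%R d1 coproduct12_linear.
Fact coproduct23_linear : linear d2.
Proof. by rewrite /d2; lin. Qed.
HB.instance Definition _ := GRing.isLinear.Build F _ _ *:%R d2 coproduct23_linear.
Fact embed12_linear : linear i12.
Proof. by rewrite /i12; lin. Qed.
HB.instance Definition _ := GRing.isLinear.Build F _ _ *:%R i12 embed12_linear.
Fact embed23_linear : linear i23.
Proof. by rewrite /i23; lin. Qed.
HB.instance Definition _ := GRing.isLinear.Build F _ _ *:%R i23 embed23_linear.

Lemma coproduct12_tens a b : d1 (tens a b) = tassoc (tens (D a) b).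
Proof. by rewrite /d1 tmap_tens. Qed.
Lemma coproduct23_tens a b : d2 (tens a b) = tens a (D b).
Proof. by rewrite /d2 tmap_tens. Qed.
Lemma coproduct12M : {morph d1 : X Y / X * Y}.
Proof. by move=> X Y; rewrite /d1 tmap_mul tassoc_mul. Qed.
Lemma coproduct23M : {morph d2 : X Y / X * Y}.
Proof. by move=> X Y; rewrite /d2 tmap_mul. Qed.
Lemma embed12M : {morph i12 : X Y / X * Y}.
Proof. by move=> X Y; rewrite /i12 -tassoc_mul tensM mulr1. Qed.
Lemma embed23M : {morph i23 : X Y / X * Y}.
Proof. by move=> X Y; rewrite /i23 tensM mulr1. Qed.
Lemma coproduct12D x : d1 (D x) = d2 (D x).
Proof. exact: coproductA. Qed.

Definition leg2_counit (X : tensor H H) : H :=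
  tlift (fun a b => (e b : F) *: a) X.
Definition leg1_counit (X : tensor H H) : H :=
  tlift (fun a b => (e a : F) *: b) X.
Definition mulS1 (X : tensor H H) : H := tlift (fun a b => S a * b) X.
Definition mulS2 (X : tensor H H) : H := tlift (fun a b => a * S b) X.
HB.instance Definition _ :=
  GRing.isLinear.Build F _ _ *:%R leg1_counit (tlift_linear _).
HB.instance Definition _ :=
  GRing.isLinear.Build F _ _ *:%R leg2_counit (tlift_linear _).
HB.instance Definition _ :=
  GRing.isLinear.Build F _ _ *:%R mulS1 (tlift_linear _).
HB.instance Definition _ :=
  GRing.isLinear.Build F _ _ *:%R mulS2 (tlift_linear _).

Lemma leg1_counit_tens a b : leg1_counit (tens a b) = (e a : F) *: b.
Proof. by rewrite /leg1_counit tlift_tens //; bil. Qed.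
Lemma leg2_counit_tens a b : leg2_counit (tens a b) = (e b : F) *: a.
Proof. by rewrite /leg2_counit tlift_tens //; bil. Qed.
Lemma mulS1_tens a b : mulS1 (tens a b) = S a * b.
Proof. by rewrite /mulS1 tlift_tens //; bil. Qed.
Lemma mulS2_tens a b : mulS2 (tens a b) = a * S b.
Proof. by rewrite /mulS2 tlift_tens //; bil. Qed.

Lemma leg1_counitM : {morph leg1_counit : X Y / X * Y}.
Proof.
move=> X Y; move: X; apply: tensor_ext; [lin | lin | move=> a b].
move: Y; apply: tensor_ext; [lin | lin | move=> a' b'].
by rewrite tensM !leg1_counit_tens rmorphM -scalerAl -scalerAr scalerA.
Qed.
Lemma leg2_counitM : {morph leg2_counit : X Y / X * Y}.
Proof.
move=> X Y; move: X; apply: tensor_ext; [lin | lin | move=> a b].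
move: Y; apply: tensor_ext; [lin | lin | move=> a' b'].
by rewrite tensM !leg2_counit_tens rmorphM -scalerAl -scalerAr scalerA.
Qed.
Lemma leg1_counitD x : leg1_counit (D x) = x. Proof. exact: counit_l. Qed.
Lemma leg2_counitD x : leg2_counit (D x) = x. Proof. exact: counit_r. Qed.
Lemma mulS1D x : mulS1 (D x) = (e x : F)%:A. Proof. exact: antipode_l. Qed.
Lemma mulS2D x : mulS2 (D x) = (e x : F)%:A. Proof. exact: antipode_r. Qed.

Lemma leg1_counit1 : leg1_counit 1 = 1.
Proof. by rewrite -tens11 leg1_counit_tens rmorph1 scale1r. Qed.

(** Convolution by the antipode undoes convolution by the identity, so that
    [x |-> c * S x] is the only solution [f] of [f * id = c eps]. *)
Lemma convolution_eq_antipode (f : H -> H) c : linear f ->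
    (forall x, tlift (fun a b => f a * b) (D x) = (e x : F) *: c) ->
  forall x, f x = c * S x.
Proof.
move=> lf fc x; pose K (Z : tensor H (tensor H H)) : H :=
  tlift (fun a Y => f a * mulS2 Y) Z.
have lK : linear K by exact: tlift_linear.
have KE a Y : K (tens a Y) = f a * mulS2 Y by rewrite /K tlift_tens //; bil.
transitivity (K (d2 (D x))).
  rewrite -{1}[x]leg2_counitD; move: (D x); apply: tensor_ext; [lin | lin |].
  move=> a b; rewrite leg2_counit_tens coproduct23_tens KE mulS2D -scalerAr mulr1.
  exact: linear_scale.
rewrite -coproduct12D -{2}[x]leg1_counitD.
move: (D x); apply: tensor_ext; [lin | lin | move=> a b].
rewrite coproduct12_tens leg1_counit_tens linearZ /= -scalerAr scalerAl -fc.
move: (D a); apply: tensor_ext; [lin | lin | move=> p q].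
by rewrite tassoc_tens KE mulS2_tens mulrA tlift_tens //; bil.
Qed.

Lemma antipode1 : S 1 = 1.
Proof.
have := mulS1D 1; rewrite rmorph1 -tens11 mulS1_tens mulr1 => ->.
by rewrite rmorph1 scale1r.
Qed.

(** Two applications of the uniqueness of convolution inverses: the map
    [b |-> S (a_1 b) a_2] is [eps(a) S], and then [x |-> S (x y)] is
    [S(y) S(x)]. *)
Lemma antipodeM x y : S (x * y) = S y * S x.
Proof.
have mulS1l X b d : mulS1 (X * tens b 1) * d = mulS1 (X * tens b d).
  move: X; apply: tensor_ext; [lin | lin | move=> p q].
  by rewrite !tensM !mulS1_tens mulr1 mulrA.
have conv a b : mulS1 (D a * tens b 1) = (e a : F)%:A * S b.
  apply: (@convolution_eq_antipode (fun b => mulS1 (D a * tens b 1)));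
    first by lin.
  move=> z; rewrite scalerA mulrC -counitM -mulS1D coproductM.
  move: (D z); apply: tensor_ext; [lin | lin | move=> c d].
  by rewrite tlift_tens ?mulS1l //; bil.
apply: (@convolution_eq_antipode (fun x => S (x * y))); first by lin.
move=> z; rewrite -[S y]mul1r scalerAl -conv.
move: (D z); apply: tensor_ext; [lin | lin | move=> c d].
by rewrite tensM mulr1 mulS1_tens tlift_tens //; bil.
Qed.

Lemma grouplike_antipode w : w != 0 -> D w = tens w w ->
  [/\ S w * w = 1, w * S w = 1 & S (S w) = w].
Proof.
move=> w0 Dw; have ew : (e w : F) = 1.
  have /eqP := leg1_counitD w; rewrite Dw leg1_counit_tens.
  rewrite -subr_eq0 -{3}[w]scale1r -scalerBl scaler_eq0 (negPf w0) orbF.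
  by rewrite subr_eq0 => /eqP.
have Sw : S w * w = 1 by rewrite -mulS1_tens -Dw mulS1D ew scale1r.
have wS : w * S w = 1 by rewrite -mulS2_tens -Dw mulS2D ew scale1r.
by split=> //; rewrite -[LHS]mulr1 -Sw mulrA -antipodeM wS antipode1 mul1r.
Qed.

End Hopf.

(** * Yetter-Drinfeld modules over pointed Hopf algebras *)

Section Misc.
Variable F : fieldType.

Lemma tlift_mem (U V W : vectType F) (f : U -> V -> W) (M : {vspace W}) X :
  (forall u v, f u v \in M) -> tlift f X \in M.
Proof.
by move=> fM; rewrite /tlift; do 2![apply: memv_suml => ? _]; apply: memvZ.
Qed.

Lemma lcontr_sum (U V : vectType F) (I : finType) (c : I -> F)
    (phi : I -> U -> F^o) (X : tensor U V) : (forall i, linear (phi i)) ->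
  lcontr (fun u => \sum_i (c i : F^o) * phi i u) X = \sum_i c i *: lcontr (phi i) X.
Proof.
move=> lphi; have lsum : linear (fun u => \sum_i (c i : F^o) * phi i u).
  move=> k x y; rewrite scaler_sumr -big_split; apply: eq_bigr => i _ /=.
  by rewrite lphi mulrPr.
have lr : linear (fun X : tensor U V => \sum_i c i *: lcontr (phi i) X).
  move=> k x y; rewrite scaler_sumr -big_split; apply: eq_bigr => i _ /=.
  by rewrite linearP scalerPr.
move: X; apply: tensor_ext; [lin | by [] | move=> a b].
rewrite lcontr_tens // scaler_suml; apply: eq_bigr => i _.
by rewrite lcontr_tens // scalerA.
Qed.

Lemma linear_sub (U : lmodType F) (V : lmodType F) (f h : U -> V) :
  linear f -> linear h -> linear (fun u => f u - h u).
Proof. by move=> lf lh k x y; rewrite lf lh opprD addrACA scalerBr. Qed.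

Lemma free_spanning (V : vectType F) (P : V -> Prop) :
  exists s : seq V, [/\ forall x, x \in s -> P x, free s
                      & forall x, P x -> x \in <<s>>%VS].
Proof.
suff ext k s : (\dim {:V} - size s <= k)%N -> (forall x, x \in s -> P x) ->
    free s -> exists s : seq V, [/\ forall x, x \in s -> P x, free s
                      & forall x, P x -> x \in <<s>>%VS].
  exact: (ext _ [::] (leqnn _)) (nil_free _).
elim: k s => [|k IH] s sk sP sfree.
  exists s; split=> // x _; suff -> : <<s>>%VS = fullv by exact: memvf.
  apply/eqP; rewrite eqEdim subvf /=.
  by move: sfree; rewrite /free => /eqP ->; rewrite -subn_eq0 -leqn0.
have [allP|] := EM (forall x, P x -> x \in <<s>>%VS); first by exists s.
move=> /existsNP[x /not_implyP[Px /negP xs]].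
apply: (IH (x :: s)).
- by rewrite /= subnS -ltnS; case: (_ - _)%N sk.
- by move=> y; rewrite inE => /predU1P[->|/sP].
- by rewrite free_cons xs.
Qed.

End Misc.

Section YetterDrinfeld.
Variables (F : fieldType) (H : hopfAlgebra F).

Local Notation D := (coproduct H).
Local Notation S := (antipode H).
Local Notation e := (counit H).
Local Notation d1 := (@coproduct12 F H).

Lemma mulS1_mul (X : tensor H H) a b : mulS1 (X * tens a b) = S a * mulS1 X * b.
Proof.
move: X; apply: tensor_ext; [lin | lin | move=> p q].
by rewrite tensM !mulS1_tens antipodeM !mulrA.
Qed.

Lemma mulS1_coproduct a (X : tensor H H) :
  mulS1 (D a * X) = (e a : F) *: mulS1 X.
Proof.
move: X; apply: tensor_ext; [lin | lin | move=> p q].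
by rewrite mulS1_mul mulS1D mulS1_tens -scalerAr mulr1 scalerAl.
Qed.

Lemma lcontr_mulr (phi : H -> F^o) (X : tensor H H) y z : linear phi ->
  lcontr phi (X * tens y z) = lcontr (fun a => phi (a * y)) X * z.
Proof.
move=> lphi; move: X; apply: tensor_ext; [lin | lin | move=> p q].
by rewrite tensM !lcontr_tens ?scalerAl //; lin.
Qed.

Lemma lcontr_mull (phi : H -> F^o) (X : tensor H H) y z : linear phi ->
  lcontr phi (tens y z * X) = z * lcontr (fun a => phi (y * a)) X.
Proof.
move=> lphi; move: X; apply: tensor_ext; [lin | lin | move=> p q].
by rewrite tensM !lcontr_tens ?scalerAr //; lin.
Qed.

Definition convolution (phi psi : H -> F^o) (h : H) : F^o :=
  psi (lcontr phi (D h)).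

Lemma convolution_linear phi psi :
  linear phi -> linear psi -> linear (convolution phi psi).
Proof. by move=> lphi lpsi; rewrite /convolution; lin. Qed.

Section Pointed.
Variables (G X : H -> Prop) (l : nat).
Hypothesis l_gt0 : (0 < l)%N.
Hypothesis G_grouplike : forall x, G x -> D x = tens x x.
Hypothesis G_comm : forall x y, G x -> G y -> GRing.comm x y.
Hypothesis G_order : forall x, G x -> x ^+ l = 1.
Hypothesis X_primitive : forall x, X x ->
  exists a b, [/\ G a, G b & D x = tens x a + tens b x].

(** Products of grouplike elements from [G] and skew-primitive elements from [X].
    The index counts the factors from [X]; it gives a coalgebra filtration whose
    degree 0 part is spanned by grouplike elements. *)
Inductive word : nat -> H -> Prop :=
| word1 : word 0 1
| word_grouplike k w x : word k w -> G x -> word k (w * x)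
| word_primitive k w x : word k w -> X x -> word k.+1 (w * x).

(** Functionals orthogonal to the filtration: [kills k] means orthogonal to the
    words of degree less than [k]. Working with them instead of subspaces of
    tensor products lets each factor of a word be absorbed in the functional. *)
Definition kills k (phi : H -> F^o) :=
  forall j w, (j < k)%N -> word j w -> phi w = 0.

Lemma killsW j k phi : (j <= k)%N -> kills k phi -> kills j phi.
Proof. by move=> jk kphi i w ij; apply: kphi; apply: leq_trans jk. Qed.

Lemma kills_grouplike k phi x :
  G x -> kills k phi -> kills k (fun a => phi (a * x)).
Proof. by move=> Gx kphi j w jk ww; apply: (kphi j) => //; constructor. Qed.

Lemma kills_primitive k phi x :
  X x -> kills k.+1 phi -> kills k (fun a => phi (a * x)).
Proof. by move=> Xx kphi j w jk ww; apply: (kphi j.+1) => //; constructor. Qed.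

Lemma word0_grouplike w :
  word 0 w -> [/\ D w = tens w w, w ^+ l = 1 & forall x, G x -> GRing.comm w x].
Proof.
move: {-1}0%N (erefl 0%N) => k k0 ww; elim: ww k0 => [|{}k {}w x _ IH Gx|//].
  split=> [||x _]; rewrite ?rmorph1 ?expr1n //; exact: commr_sym (commr1 _).
move=> /IH[Dw wl wC]; split; first by rewrite coproductM Dw G_grouplike ?tensM.
  by rewrite exprMn_comm ?wl ?G_order ?mul1r //; apply: wC.
move=> y Gy; apply: commr_sym; apply: commrM; apply: commr_sym;
  [exact: wC | exact: G_comm].
Qed.

(** The words of degree less than [k] span a right coideal. *)
Lemma word_lcontr0 k j w phi : linear phi -> kills k phi ->
  (j < k)%N -> word j w -> lcontr phi (D w) = 0.
Proof.
move=> lphi kphi jk ww; elim: ww k phi lphi kphi jk => {w j}.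
- move=> k phi lphi kphi k0; rewrite rmorph1 -tens11 lcontr_tens //.
  by rewrite (kphi 0%N) ?scale0r //; constructor.
- move=> j w x _ IH Gx k phi lphi kphi jk.
  rewrite coproductM (G_grouplike Gx) lcontr_mulr // (IH k) ?mul0r //; first by lin.
  exact: kills_grouplike.
move=> j w x _ IH Xx [//|k] phi lphi kphi jk.
have [a [b [Ga Gb Dx]]] := X_primitive Xx.
rewrite coproductM Dx mulrDr linearD /= !lcontr_mulr // (IH k); last 1 first.
- by [].
- rewrite mul0r add0r (IH k.+1) ?mul0r //; first by lin.
    exact: kills_grouplike.
  exact: leq_trans (leqnSn _).
- by lin.
exact: kills_primitive.
Qed.

(** Dual form of the filtration property: the coproduct of a word of degree [k]
    lies in the sum of [F_(k-1) (x) H] and [H (x) F_0], where [F_j] is the span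
    of the words of degree at most [j]. *)
Lemma kills_convolution k phi psi : linear phi -> linear psi ->
  kills k phi -> kills 1 psi -> kills k.+1 (convolution phi psi).
Proof.
move=> lphi lpsi kphi kpsi j w; rewrite ltnS /convolution => jk ww.
elim: ww k phi psi lphi lpsi kphi kpsi jk => {w j}.
- move=> k phi psi lphi lpsi kphi kpsi _; rewrite rmorph1 -tens11 lcontr_tens //.
  by rewrite linear_scale // (kpsi 0%N) ?scaler0 //; constructor.
- move=> j w x _ IH Gx k phi psi lphi lpsi kphi kpsi jk.
  rewrite coproductM (G_grouplike Gx) lcontr_mulr //.
  apply: (IH k (fun a => phi (a * x)) (fun a => psi (a * x))) => //.
  + by lin.
  + by lin.
  + exact: kills_grouplike.
  + exact: kills_grouplike.
move=> j w x ww IH Xx [//|k] phi psi lphi lpsi kphi kpsi jk.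
have [a [b [Ga Gb Dx]]] := X_primitive Xx.
rewrite coproductM Dx mulrDr linearD /= !lcontr_mulr //.
rewrite (@word_lcontr0 k.+1 j w (fun u => phi (u * b))) ?mul0r ?addr0 //;
  last 2 first.
- by lin.
- exact: kills_grouplike.
apply: (IH k (fun u => phi (u * x)) (fun u => psi (u * a))) => //.
- by lin.
- by lin.
- exact: kills_primitive.
- exact: kills_grouplike.
Qed.

Hypothesis word_span : exists N, forall phi, linear phi -> kills N phi ->
  forall h, phi h = 0.

(* A left Yetter-Drinfeld structure on the regular left module [H]. *)
Variable rho : {linear H -> tensor H H}.
Hypothesis rho_counit : forall m, leg1_counit (rho m) = m.
Hypothesis rhoA : forall m, d1 (rho m) = tmap idfun rho (rho m).
Hypothesis rho_mul : forall h m,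
  rho (h * m) = tlift (fun a b => D a * rho m * tens (S b) 1) (D h).

(** The coaction seen as a right action of the dual algebra, for the product
    [convolution]. *)
Definition dual_act (phi : H -> F^o) (m : H) : H := lcontr phi (rho m).
Local Notation R := dual_act.

Lemma dual_actM phi psi m : linear phi -> linear psi ->
  R psi (R phi m) = R (convolution phi psi) m.
Proof.
move=> lphi lpsi; rewrite /R.
have -> : rho (lcontr phi (rho m)) = lcontr phi (tmap idfun rho (rho m)).
  move: (rho m); apply: tensor_ext; [lin | lin | move=> a b].
  by rewrite tmap_tens !lcontr_tens // linearZ.
have lc := convolution_linear lphi lpsi.
rewrite -rhoA; move: (rho m); apply: tensor_ext; [lin | lin | move=> a b].
rewrite coproduct12_tens lcontr_tens // /convolution.
move: (D a); apply: tensor_ext; [lin | lin | move=> p q].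
rewrite tassoc_tens !lcontr_tens // !linearZ /= lcontr_tens //.
by rewrite (linear_scale _ _ lpsi) scalerA; congr (_ *: _); exact: mulrC.
Qed.

(** The Yetter-Drinfeld submodules. *)
Definition stable (M : {vspace H}) :=
  (forall h m, m \in M -> h * m \in M) /\
  (forall phi m, linear phi -> m \in M -> R phi m \in M).

Lemma stable_lcontr M Y : stable M ->
  (forall phi, linear phi -> lcontr phi Y \in M) -> mulS1 Y \in M.
Proof.
move=> [Ml _] YM; rewrite [Y]lcontr_coord linear_sum; apply: memv_suml => i _ /=.
by rewrite mulS1_tens; apply: Ml; apply: YM; lin.
Qed.

(** The ideal of functionals orthogonal to the words of degree 0 is nilpotent by
    [kills_convolution], so some nonzero vector of the quotient by [M] is killed
    by all of it. *)
Lemma stable_killed_vector M : stable M -> M != fullv ->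
  exists2 m, m \notin M & forall phi, linear phi -> kills 1 phi -> R phi m \in M.
Proof.
move=> [_ Mr] Mfull; have [N spanN] := word_span.
have [m0 m0M] : exists m, m \notin M.
  have [//|noM] := EM (exists m, m \notin M); case/eqP: Mfull; apply/eqP.
  rewrite eqEsubv subvf; apply/subvP => x _; apply/negPn/negP => xM.
  by apply: noM; exists x.
have: exists2 m, m \notin M & forall phi, linear phi -> kills N phi -> R phi m \in M.
  exists m0 => // phi lphi /(spanN _ lphi) phi0.
  suff -> : R phi m0 = 0 by exact: mem0v.
  rewrite /R; move: (rho m0); apply: tensor_ext; [lin | by move=> k x y; rewrite scaler0 addr0 | move=> a b].
  by rewrite lcontr_tens // phi0 scale0r.
elim: N {spanN} => [|k IH] [m mM mkill].
  by exists m => // phi lphi kphi; apply: mkill => // j w.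
have [allk|] := EM (forall phi, linear phi -> kills k phi -> R phi m \in M).
  by apply: IH; exists m.
move=> /existsNP[phi /not_implyP[lphi /not_implyP[kphi /negP nM]]].
exists (R phi m) => // psi lpsi kpsi; rewrite dual_actM //.
by apply: mkill; [exact: convolution_linear | exact: kills_convolution].
Qed.

(** On the vectors of [stable_killed_vector] the dual algebra acts through the
    functions on the grouplike words of degree 0; these have a basis of
    idempotents, and a nonzero projection is an eigenvector. *)
Lemma stable_eigenvector M : stable M -> M != fullv ->
  exists m w, [/\ m \notin M, word 0 w
    & forall phi, linear phi -> R phi m - (phi w : F) *: m \in M].
Proof.
move=> Mst Mfull; have [m mM mkill] := stable_killed_vector Mst Mfull.
have [s [sw sfree sspan]] := free_spanning (word 0).
have kills1 phi : linear phi -> (forall i : 'I_(size s), phi s`_i = 0) -> kills 1 phi.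
  move=> lphi phi0 j w; rewrite ltnS leqn0 => /eqP -> /sspan.
  rewrite -[s]/(tval (in_tuple s)) => /coord_span ->; rewrite sum_linear //.
  by rewrite big1 // => i _; rewrite phi0 scaler0.
pose dl (i : 'I_(size s)) : H -> F^o := coord (in_tuple s) i.
have ldl i : linear (dl i) by rewrite /dl; lin.
have dlE (i j : 'I_(size s)) : dl i s`_j = (i == j)%:R.
  by rewrite /dl -[s in s`_j]/(tval (in_tuple s)) coord_free // eq_sym.
(* The counit acts as the identity and is, on words of degree 0, a combination
   of the coordinate functionals, so these cannot all map [m] into [M]. *)
have [i Ri] : exists i, R (dl i) m \notin M.
  have [//|noi] := EM (exists i, R (dl i) m \notin M); case/negP: mM.
  have allM k : R (dl k) m \in M.
    by apply/negPn/negP => kM; apply: noi; exists k.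
  pose f (u : H) : F^o := \sum_(i < size s) ((e s`_i : F) : F^o) * dl i u.
  have lf : linear f.
    move=> k x y; rewrite scaler_sumr -big_split; apply: eq_bigr => i _ /=.
    by rewrite ldl mulrPr.
  pose f' (u : H) : F^o := e u - f u.
  have lf' : linear f' by apply: linear_sub => //; exact: linearP.
  have Rf' : R f' m = m - R f m.
    rewrite -[X in X - _]rho_counit /R.
    move: (rho m); apply: tensor_ext; [lin | by apply: linear_sub; lin | move=> a b].
    by rewrite leg1_counit_tens !lcontr_tens // scalerBl.
  rewrite -[m](subrK (R f m)) -Rf' memvD //.
    apply: mkill => //; apply: kills1 => // j; rewrite /f' /f (bigD1 j) //= dlE eqxx.
    rewrite mulr1 big1 ?addr0 ?subrr // => k kj.
    by rewrite dlE (negPf kj) mulr0.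
  rewrite /R lcontr_sum //; apply: memv_suml => k _; apply: memvZ; exact: allM.
have swi : word 0 s`_i by apply/sw/mem_nth.
exists (R (dl i) m), s`_i; split=> // phi lphi; rewrite dual_actM //.
have lc := convolution_linear (ldl i) lphi.
have lf : linear (fun u => convolution (dl i) phi u - phi s`_i * dl i u).
  by apply: linear_sub => // k x y; rewrite ldl mulrPr.
have -> : R (convolution (dl i) phi) m - (phi s`_i : F) *: R (dl i) m
        = R (fun u => convolution (dl i) phi u - phi s`_i * dl i u) m.
  rewrite /R; move: (rho m); apply: tensor_ext; [|lin| move=> a b].
    by apply: linear_sub; lin.
  by rewrite !lcontr_tens // scalerA -scalerBl.
apply: mkill => //; apply: kills1 => // j.
have /word0_grouplike[Dw _ _] : word 0 s`_j by apply/sw/mem_nth.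
rewrite /convolution Dw lcontr_tens // linear_scale // dlE.
case: eqP => [->|_]; first by rewrite scale1r mulr1 subrr.
by rewrite scale0r mulr0 subrr.
Qed.

(** The map [m |-> S(m_(-1)) m_(0)] by which the Drinfeld element of the double
    acts on Yetter-Drinfeld modules, up to inversion. *)
Definition drinfeld (m : H) : H := mulS1 (rho m).
Local Notation T := drinfeld.
Fact drinfeld_linear : linear T.
Proof. by rewrite /T; lin. Qed.
HB.instance Definition _ := GRing.isLinear.Build F _ _ *:%R T drinfeld_linear.

Definition antipode2 (h : H) : H := S (S h).

Lemma antipode2M : {morph antipode2 : x y / x * y}.
Proof. by move=> x y; rewrite /antipode2 !antipodeM. Qed.

Lemma drinfeld_mul h m : T (h * m) = antipode2 h * T m.
Proof.
rewrite /T rho_mul -[h in RHS]leg1_counitD.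
move: (D h); apply: tensor_ext; [lin | by rewrite /antipode2; lin | move=> p q].
rewrite tlift_tens; last by bil.
rewrite mulS1_mul mulS1_coproduct mulr1 leg1_counit_tens /antipode2 !linearZ /=.
by rewrite -scalerAr scalerAl.
Qed.

Lemma iter_drinfeld n h : iter n T h = iter n antipode2 h * iter n T 1.
Proof. by elim: n => [|n IH]; rewrite /= ?mulr1 // IH drinfeld_mul. Qed.

Lemma stable_drinfeld M m n : stable M -> m \in M -> iter n T m \in M.
Proof.
move=> Mst mM; elim: n => //= n IH; apply: stable_lcontr => // phi lphi.
exact: Mst.2.
Qed.

(** If the coaction of [m] is [w (x) m] modulo [M], then [drinfeld] multiplies [m]
    by [S w], the inverse of [w], and [S ^ 2] fixes [w]. *)
Lemma drinfeld_eigenvector M m w : stable M -> word 0 w ->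
    (forall phi, linear phi -> R phi m - (phi w : F) *: m \in M) ->
  iter l T m - m \in M.
Proof.
move=> Mst /word0_grouplike[Dw wl _] Rm.
have w_neq0 : w != 0.
  by apply: contra_eq_neq wl => ->; rewrite expr0n eqn0Ngt l_gt0 eq_sym oner_neq0.
have [Sw wS SSw] := grouplike_antipode w_neq0 Dw.
have Swn n : antipode2 (S w ^+ n) = S w ^+ n.
  elim: n => [|n IH]; first by rewrite /antipode2 !antipode1.
  by rewrite exprS antipode2M IH /antipode2 SSw.
have Tm : T m - S w * m \in M.
  have -> : T m - S w * m = mulS1 (rho m - tens w m).
    by rewrite linearB /= mulS1_tens.
  apply: stable_lcontr => // phi lphi.
  by rewrite linearB /= lcontr_tens //; apply: Rm.
have Tn n : iter n T m - S w ^+ n * m \in M.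
  elim: n => [|n IH]; first by rewrite mul1r subrr mem0v.
  rewrite /= -[iter n T m](subrK (S w ^+ n * m)) linearD /= drinfeld_mul Swn.
  rewrite -addrA memvD //; first exact: (stable_drinfeld 1).
  by rewrite exprSr -mulrA -mulrBr; apply: Mst.1.
have := Tn l; suff -> : S w ^+ l = 1 by rewrite mul1r.
by rewrite -[LHS]mulr1 -wl -exprMn_comm ?Sw ?expr1n // /GRing.comm Sw wS.
Qed.

(** By the compatibility of action and coaction, it is enough to check the
    coaction on a generator of a submodule. *)
Lemma stable_add_orbit M m : stable M ->
    (forall phi, linear phi -> R phi m \in (M + <[m]>)%VS) ->
  stable (M + limg (amulr m)).
Proof.
move=> [Ml Mr] Rm; set M' := (M + _)%VS.
have M'l h x : x \in M' -> h * x \in M'.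
  move=> /memv_addP[y yM [z /memv_imgP[b _ ->] ->]]; rewrite mulrDr memv_add ?Ml //.
  apply/memv_imgP; exists (h * b); rewrite ?memvf //.
  by rewrite !lfunE /= mulrA.
have M'R phi : linear phi -> R phi m \in M'.
  move=> /Rm; apply: subvP; apply: addvS => //.
  rewrite -memvE; apply/memv_imgP; exists 1; rewrite ?memvf //.
  by rewrite lfunE /= mul1r.
split=> // phi x lphi /memv_addP[y yM [z /memv_imgP[b _ ->] ->]].
rewrite /R !linearD /= memvD //; first by apply/(subvP (addvSl _ _))/Mr.
rewrite lfunE /= rho_mul tlift_comp; last by lin.
apply: tlift_mem => p q.
have -> : lcontr phi (D p * rho m * tens (S q) 1)
        = tlift (fun a b => lcontr phi (tens a b * rho m * tens (S q) 1)) (D p).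
  move: (D p); apply: tensor_ext; [lin | lin | move=> a c].
  by rewrite tlift_tens //; bil.
apply: tlift_mem => a c; rewrite lcontr_mulr // mulr1 lcontr_mull; last by lin.
by apply: M'l; apply: M'R; lin.
Qed.

Hypothesis antipode_order : forall h, iter l antipode2 h = h.

(** Induction on the codimension of [M], with the claim that some power of
    [Z - 1] maps [H] into [M]: an eigenvector modulo [M] is fixed by [Z] modulo
    [M], and so is all that it generates, as [T ^ l] is left [H]-linear. *)
Theorem drinfeld_power_unipotent : exists k, (iter l T 1 - 1) ^+ k = 0.
Proof.
set Z := iter l T 1.
have TZ h : iter l T h = h * Z by rewrite iter_drinfeld antipode_order.
suff nil d M : (\dim {:H} - \dim M <= d)%N -> stable M ->
    exists k, forall h, h * (Z - 1) ^+ k \in M.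
  have [|k kZ] := nil _ 0%VS (leqnn _).
    split=> [h m|phi m lphi]; rewrite !memv0 => /eqP ->; first by rewrite mulr0.
    by rewrite /R !linear0.
  by exists k; have := kZ 1; rewrite mul1r memv0 => /eqP.
elim: d M => [|d IH] M dM Mst; (have [->|Mfull] := eqVneq M fullv;
  first by exists 0%N => h; exact: memvf).
  by case/negP: Mfull; rewrite eqEdim subvf /= -subn_eq0 -leqn0.
have [m [w [mM w0 Rm]]] := stable_eigenvector Mst Mfull.
have mZ : m * (Z - 1) \in M.
  by rewrite mulrBr mulr1 -TZ; apply: drinfeld_eigenvector w0 Rm.
have Mst' : stable (M + limg (amulr m)).
  apply: stable_add_orbit => // phi lphi.
  by rewrite -[R phi m](subrK ((phi w : F) *: m)) memv_add ?Rm ?memvZ ?memv_line.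
have [|k kM'] := IH _ _ Mst'.
  rewrite -ltnS; apply: leq_trans dM; apply: ltn_sub2l.
    by rewrite ltn_neqAle dimvS ?subvf // andbT; apply: contra Mfull;
      rewrite eqEdim subvf /= => /eqP ->.
  rewrite ltn_neqAle dimvS ?addvSl // andbT.
  apply: contra mM => /eqP dimE.
  have -> : M = (M + limg (amulr m))%VS by apply/eqP; rewrite eqEdim addvSl dimE /=.
  apply: (subvP (addvSr _ _)).
  by apply/memv_imgP; exists 1; rewrite ?memvf // lfunE /= mul1r.
exists k.+1 => h; rewrite exprSr mulrA.
have /memv_addP[y yM [z /memv_imgP[b _ ->] ->]] := kM' h.
rewrite mulrDl memvD //.
  rewrite mulrBr mulr1 -TZ memvB //; exact: stable_drinfeld.
by rewrite lfunE /= -mulrA; apply: Mst.1.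
Qed.

End Pointed.
End YetterDrinfeld.

(** * The half-braiding attached to a twisted grouplike element *)

Lemma falg_inverseC (F : fieldType) (A : falgType F) (x y : A) :
  x * y = 1 -> y * x = 1.
Proof.
move=> xy1; have inj : lker (amulr x) == 0%VS.
  apply/lker0P => u v; rewrite !lfunE /= => uv.
  by rewrite -[u]mulr1 -[v]mulr1 -xy1 !mulrA uv.
have /(_ 1)/memv_imgP[u _] : forall w, w \in limg (amulr x).
  by move=> w; rewrite (lker0_limgf inj) memvf.
rewrite lfunE /= => ux1; suff -> : y = u by [].
by rewrite -[y]mul1r ux1 -mulrA xy1 mulr1.
Qed.

Lemma tmap_mull (F : fieldType) (A B : falgType F) (c : B) (a : A) (b : B) :
  tmap (idfun : A -> A) (fun x => c * x) (tens a b) = tens a (c * b).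
Proof. rewrite /tmap tlift_tens //; bil. Qed.

Section Twisted.
Variables (F : fieldType) (H : hopfAlgebra F).

Local Notation D := (coproduct H).
Local Notation S := (antipode H).
Local Notation e := (counit H).
Local Notation d1 := (@coproduct12 F H).
Local Notation d2 := (@coproduct23 F H).
Local Notation i12 := (@embed12 F H).
Local Notation i23 := (@embed23 F H).

Variable J : tensor H H.

Hypothesis J_unit : J \is a GRing.unit.
Hypothesis J_cocycle : d1 J * i12 J = d2 J * i23 J.
Hypothesis J_counit1 : leg1_counit J = 1.
Hypothesis J_counit2 : leg2_counit J = 1.

Lemma coproduct12_1 : d1 1 = 1.
Proof. by rewrite -tens11 coproduct12_tens rmorph1 -tens11 tassoc_tens. Qed.
Lemma embed23_1 : i23 1 = 1. Proof. by []. Qed.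

(** The element [Q] for which the antipode of the twisted Hopf algebra is
    [Q^-1 S Q]. *)
Definition twist_antipode : H := mulS1 J.
Local Notation Q := twist_antipode.

(** Applying [a (x) b (x) c |-> S(a) b S(c)] to
    [(J (x) 1) (1 (x) J^-1) = (D (x) id)(J^-1) (id (x) D)(J)] gives [Q] times its
    inverse on the left, and on the right all coproducts cancel. *)
Lemma twist_antipode_inverse : Q * mulS2 J^-1 = 1.
Proof.
pose K (Z : tensor H (tensor H H)) : H := tlift (fun a Y => S a * mulS2 Y) Z.
have lK : linear K by exact: tlift_linear.
have KE a Y : K (tens a Y) = S a * mulS2 Y by rewrite /K tlift_tens //; bil.
have K_embed X Y : K (i12 X * i23 Y) = mulS1 X * mulS2 Y.
  move: X; apply: tensor_ext; [lin | lin | move=> p q].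
  move: Y; apply: tensor_ext; [lin | lin | move=> x y].
  rewrite /i12 tassoc_tens !tensM mulr1 mul1r KE.
  by rewrite mulS1_tens !mulS2_tens !mulrA.
have K_coproduct X Y :
    K (d1 X * d2 Y) = S (leg1_counit X * leg2_counit Y).
  move: X; apply: tensor_ext; [lin | lin | move=> x y].
  move: Y; apply: tensor_ext; [lin | lin | move=> a b].
  rewrite coproduct12_tens coproduct23_tens leg1_counit_tens leg2_counit_tens.
  transitivity (S a * mulS1 (D x) * (mulS2 (D b) * S y)).
    move: (D x); apply: tensor_ext; [lin | lin | move=> p q].
    move: (D b); apply: tensor_ext; [lin | lin | move=> r s].
    rewrite tassoc_tens !tensM KE mulS1_tens !mulS2_tens !antipodeM.
    by rewrite !mulrA.
  rewrite mulS1D mulS2D -!scalerAl -!scalerAr -scalerAl !linearZ !mulr1 mul1r.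
  by rewrite antipodeM.
rewrite -K_embed.
have -> : i12 J * i23 J^-1 = d1 J^-1 * d2 J.
  rewrite -[LHS]mul1r -coproduct12_1 -(mulVr J_unit) coproduct12M -!mulrA.
  congr (_ * _).
  by rewrite mulrA J_cocycle -mulrA -embed23M divrr // embed23_1 mulr1.
rewrite K_coproduct J_counit2 mulr1.
suff -> : leg1_counit J^-1 = 1 by exact: antipode1.
by rewrite -[LHS]mul1r -{1}J_counit1 -leg1_counitM divrr // leg1_counit1.
Qed.

Lemma twist_antipode_unit : Q \is a GRing.unit.
Proof.
apply/unitrP; exists (mulS2 J^-1); split; last exact: twist_antipode_inverse.
exact/falg_inverseC/twist_antipode_inverse.
Qed.

(** The inverse of [m (x) x |-> D m * J * (1 (x) x)]. *)
Definition unbraid (Y : tensor H H) : tensor H H :=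
  tmap idfun (fun x => Q^-1 * x) (tmap idfun (@mulS1 F H) (d1 Y * i12 J)).

Lemma unbraid_gen m x : unbraid (D m * J * tens 1 x) = tens m x.
Proof.
pose K : tensor H (tensor H H) -> tensor H H := tmap idfun (@mulS1 F H).
have lK : linear K by exact: linearP.
have KE a Y : K (tens a Y) = tens a (mulS1 Y) by exact: tmap_tens.
have K_d2 X Y : K (d2 X * i23 Y) = tens (leg2_counit X) (mulS1 Y).
  move: X; apply: tensor_ext; [lin | lin | move=> a b].
  rewrite coproduct23_tens tensM mulr1 KE mulS1_coproduct leg2_counit_tens.
  by rewrite tensZl tensZr.
have K_right Z : K (Z * tens 1 (tens 1 x)) = K Z * tens 1 x.
  move: Z; apply: tensor_ext; [lin | lin | move=> a Y].
  by rewrite tensM !KE mulS1_mul antipode1 mul1r tensM.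
rewrite /unbraid -/K coproduct12M -mulrA.
have -> : d1 (tens 1 x) * i12 J = i12 J * tens 1 (tens 1 x).
  rewrite coproduct12_tens rmorph1 -[X in _ = _ * X]tassoc_tens.
  by rewrite /i12 -!tassoc_mul !tensM !mul1r !mulr1.
rewrite mulrA K_right coproduct12M -mulrA J_cocycle coproduct12D mulrA.
rewrite -coproduct23M K_d2 leg2_counitM leg2_counitD J_counit2 mulr1 tensM mulr1.
rewrite tmap_mull.
by rewrite mulKr // twist_antipode_unit.
Qed.

Fact unbraid_linear : linear unbraid.
Proof. by rewrite /unbraid; lin. Qed.
HB.instance Definition _ :=
  GRing.isLinear.Build F _ _ *:%R unbraid unbraid_linear.

(** As [H] is finite-dimensional, a map with a left inverse is onto, so that
    linear maps on [tensor H H] may be compared on the elements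
    [D m * J * (1 (x) x)]. *)
Lemma braid_ext (W : vectType F) (f h : tensor H H -> W) :
    linear f -> linear h ->
    (forall m x, f (D m * J * tens 1 x) = h (D m * J * tens 1 x)) ->
  f =1 h.
Proof.
move=> lf lh fh Y.
pose P (X : tensor H H) : tensor H H := tlift (fun m x => D m * J * tens 1 x) X.
have lP : linear P by exact: tlift_linear.
have PE m x : P (tens m x) = D m * J * tens 1 x by rewrite /P tlift_tens //; bil.
have PK : cancel P unbraid.
  by apply: tensor_ext; [lin | by [] | move=> m x; rewrite PE unbraid_gen].
pose LP := GRing.isLinear.Build F _ _ *:%R P lP.
pose P' : {linear tensor H H -> tensor H H} := HB.pack P LP.
have inj : lker (linfun P') == 0%VS.
  by apply/lker0P => u v; rewrite !lfunE /= => /(can_inj PK).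
have /memv_imgP[X _ ->] : Y \in limg (linfun P').
  by rewrite (lker0_limgf inj) memvf.
rewrite lfunE /=; move: X; apply: tensor_ext; [lin | lin | move=> m x].
by rewrite PE.
Qed.

Variable g : H.
Hypothesis g_neq0 : g != 0.
Hypothesis g_grouplike : D g * J = J * tens g g.

(** The half-braiding of the induced module (first factor of the source, second
    factor of the target) with the regular module. Over the twisted Hopf algebra
    it fixes the generator [1] of the former and multiplies the latter by [g]. *)
Definition half_braiding (Y : tensor H H) : tensor H H :=
  tlift (fun m x => D m * J * tens (g * x) 1) (unbraid Y).
Local Notation c := half_braiding.

Fact half_braiding_linear : linear c.
Proof. by move=> k X Y; rewrite /c linearP tlift_linear. Qed.
HB.instance Definition _ :=
  GRing.isLinear.Build F _ _ *:%R c half_braiding_linear.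

Lemma half_braiding_gen m x :
  c (D m * J * tens 1 x) = D m * J * tens (g * x) 1.
Proof. by rewrite /c unbraid_gen tlift_tens //; bil. Qed.

Lemma half_braiding_coproduct h Y : c (D h * Y) = D h * c Y.
Proof.
move: Y; apply: braid_ext; [lin | lin | move=> m x].
by rewrite half_braiding_gen !mulrA -!coproductM half_braiding_gen.
Qed.

Lemma half_braiding_right x Y : c (Y * tens 1 x) = c Y * tens x 1.
Proof.
move: Y; apply: braid_ext; [lin | lin | move=> m z].
rewrite -[_ * tens 1 z * _]mulrA tensM mulr1 !half_braiding_gen.
by rewrite -[RHS]mulrA tensM mulr1 mulrA.
Qed.

Lemma half_braiding_twist : c J = J * tens g 1.
Proof.
have := half_braiding_gen 1 1.
by rewrite rmorph1 !mul1r mulr1 tens11 mulr1.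
Qed.

Lemma twisted_grouplike_counit : (e g : F) = 1.
Proof.
have := congr1 (@leg1_counit F H) g_grouplike.
rewrite !leg1_counitM leg1_counitD J_counit1 leg1_counit_tens mulr1 mul1r.
move/eqP; rewrite -subr_eq0 -{1}[g]scale1r -scalerBl scaler_eq0 (negPf g_neq0).
by rewrite orbF subr_eq0 => /eqP <-.
Qed.

Lemma half_braiding_counit Y : leg1_counit (c Y) = leg2_counit Y.
Proof.
move: Y; apply: braid_ext; [lin | lin | move=> m x].
rewrite half_braiding_gen !leg1_counitM !leg2_counitM leg1_counitD leg2_counitD.
rewrite J_counit1 J_counit2 !mulr1 leg1_counit_tens leg2_counit_tens counitM.
by rewrite twisted_grouplike_counit mul1r.
Qed.

Definition coaction (m : H) : tensor H H := c (tens m 1).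
Fact coaction_linear : linear coaction.
Proof. by rewrite /coaction; lin. Qed.
HB.instance Definition _ :=
  GRing.isLinear.Build F _ _ *:%R coaction coaction_linear.

Lemma half_braiding_tens m x : c (tens m x) = coaction m * tens x 1.
Proof. by rewrite -half_braiding_right tensM mulr1 mul1r. Qed.

Lemma coaction_counit m : leg1_counit (coaction m) = m.
Proof. by rewrite half_braiding_counit leg2_counit_tens rmorph1 scale1r. Qed.

(** Hexagon identity: [A] braids the induced module with the tensor square of the
    regular module in one step, [C23 \o C12] in two. Both send
    [D3 m * J3 * (1 (x) w1 (x) w2)] to [D3 m * J3 * (g w1 (x) g w2 (x) 1)], where
    [D3] is the iterated coproduct and [J3] either side of the twist equation:
    the right-hand form is used for the braiding of the last two factors, the
    left-hand one for that of the first two. *)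
Lemma coactionA m : d1 (coaction m) = tmap idfun coaction (coaction m).
Proof.
pose A (Z : tensor H (tensor H H)) : tensor H (tensor H H) :=
  tlift (fun p W => d1 (coaction p) * i12 W) Z.
pose C12 (Z : tensor H (tensor H H)) : tensor H (tensor H H) :=
  tlift (fun p W => tlift (fun q s => tassoc (tens (c (tens p q)) s)) W) Z.
pose C23 (Z : tensor H (tensor H H)) : tensor H (tensor H H) := tmap idfun c Z.
have lA : linear A by exact: tlift_linear.
have lC12 : linear C12 by exact: tlift_linear.
have lC23 : linear C23 by exact: linearP.
have AE p W : A (tens p W) = d1 (coaction p) * i12 W by rewrite /A tlift_tens //; bil.
have C12E U s : C12 (tassoc (tens U s)) = tassoc (tens (c U) s).
  move: U; apply: tensor_ext; [lin | lin | move=> p q].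
  by rewrite tassoc_tens /C12 !tlift_tens //; bil.
have C23E p Y : C23 (tens p Y) = tens p (c Y) by exact: tmap_tens.
have C12_d1 Y X : C12 (d1 Y * i12 X) = d1 Y * i12 (c X).
  move: Y; apply: tensor_ext; [lin | lin | move=> a b].
  rewrite coproduct12_tens /i12 -!tassoc_mul !tensM !mulr1 C12E.
  by rewrite half_braiding_coproduct.
have C23_d2 Y X : C23 (d2 Y * i23 X) = d2 Y * i23 (c X).
  move: Y; apply: tensor_ext; [lin | lin | move=> a b].
  by rewrite coproduct23_tens !tensM !mulr1 C23E half_braiding_coproduct.
have C12_right Z x y :
    C12 (Z * tens 1 (tens x y)) = C12 Z * tens x (tens 1 y).
  move: Z; apply: tensor_ext; [lin | lin | move=> p W].
  move: W; apply: tensor_ext; [lin | lin | move=> q s].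
  rewrite !tensM mulr1 -!tassoc_tens !C12E -tassoc_mul tensM.
  by rewrite -half_braiding_right tensM mulr1.
have C23_right Z x y :
    C23 (Z * tens x (tens 1 y)) = C23 Z * tens x (tens y 1).
  move: Z; apply: tensor_ext; [lin | lin | move=> p W].
  by rewrite tensM !C23E half_braiding_right tensM.
have A_d2 Y w : A (d2 Y * i23 w) = d1 (c Y) * i12 w.
  move: Y; apply: tensor_ext; [lin | lin | move=> p q].
  rewrite coproduct23_tens tensM mulr1 AE half_braiding_tens coproduct12M.
  rewrite [in RHS]coproduct12_tens -/(i12 (D q)) -mulrA; congr (_ * _).
  exact: embed12M.
have twistA n : d1 (D n * J) * i12 J = d2 (D n * J) * i23 J.
  by rewrite coproduct12M coproduct23M -!mulrA J_cocycle coproduct12D.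
have hexagon Y w : A (d2 Y * i23 w) = C23 (C12 (d2 Y * i23 w)).
  move: Y; apply: (braid_ext (f := fun Y => A (d2 Y * i23 w))
    (h := fun Y => C23 (C12 (d2 Y * i23 w)))); [lin | lin | move=> m' x].
  have -> : d2 (D m' * J * tens 1 x) * i23 w
          = d2 (D m' * J) * i23 (J * (J^-1 * (D x * w))).
    rewrite mulVKr // coproduct23M -mulrA; congr (_ * _).
    by rewrite coproduct23_tens embed23M.
  move: (J^-1 * _); apply: tensor_ext; [lin | lin | move=> w1 w2].
  have -> : d2 (D m' * J) * i23 (J * tens w1 w2)
          = d1 (D m' * J) * i12 J * tens 1 (tens w1 w2).
    by rewrite twistA embed23M mulrA.
  have cg : c (D m' * J) = D m' * J * tens g 1.
    by have := half_braiding_gen m' 1; rewrite mulr1 tens11 mulr1.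
  have C12_gen : C12 (d1 (D m' * J) * i12 J * tens 1 (tens w1 w2))
      = d2 (D m' * J) * i23 J * tens (g * w1) (tens 1 w2).
    rewrite C12_right C12_d1 half_braiding_twist embed12M mulrA twistA -mulrA.
    by rewrite /i12 tassoc_tens !tensM !mul1r.
  have C23_gen : C23 (d2 (D m' * J) * i23 J * tens (g * w1) (tens 1 w2))
      = d1 (D m' * J) * i12 J * i12 (tens (g * w1) (g * w2)).
    rewrite C23_right C23_d2 half_braiding_twist embed23M mulrA twistA -mulrA.
    by rewrite /i12 tassoc_tens /i23 !tensM mul1r mulr1.
  have A_gen : A (d2 (D m' * J) * i23 (J * tens w1 w2))
      = d1 (D m' * J) * i12 J * i12 (tens (g * w1) (g * w2)).
    rewrite A_d2 cg coproduct12M coproduct12_tens -/(i12 (D g)) -!mulrA.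
    by rewrite -!embed12M mulrA g_grouplike -mulrA tensM.
  rewrite C12_gen C23_gen -A_gen; congr A.
  by rewrite embed23M mulrA twistA.
have hexagon1 : A (tens m 1) = C23 (C12 (tens m 1)).
  have := hexagon (tens m 1) 1; rewrite coproduct23_tens rmorph1.
  by rewrite embed23_1 mulr1.
move: hexagon1; rewrite AE /i12 -tens11 tassoc_tens !tens11 mulr1 => ->.
rewrite -[tens m 1]/(tens m (tens 1 1)) -tassoc_tens C12E -/(coaction m).
move: (coaction m); apply: tensor_ext; [lin | lin | move=> a b].
by rewrite tassoc_tens C23E tmap_tens.
Qed.

(** Writing [h m (x) 1] as [D(h_1) (m (x) S(h_2))] turns the left linearity of the
    half-braiding into the compatibility of action and coaction. *)
Lemma coaction_mul h m :
  coaction (h * m) = tlift (fun a b => D a * coaction m * tens (S b) 1) (D h).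
Proof.
pose K (Z : tensor H (tensor H H)) : tensor H H :=
  tlift (fun a Y => tens (a * m) (mulS2 Y)) Z.
have lK : linear K by exact: tlift_linear.
have KE a Y : K (tens a Y) = tens (a * m) (mulS2 Y).
  by rewrite /K tlift_tens //; bil.
have K_d1 : K (d1 (D h)) = tlift (fun a b => D a * tens m (S b)) (D h).
  move: (D h); apply: tensor_ext; [lin | lin | move=> p q].
  rewrite coproduct12_tens tlift_tens; last by bil.
  move: (D p); apply: tensor_ext; [lin | lin | move=> r s].
  by rewrite tassoc_tens KE mulS2_tens tensM.
have K_d2 : K (d2 (D h)) = tens (h * m) 1.
  rewrite -[h in RHS]leg2_counitD.
  move: (D h); apply: tensor_ext; [lin | lin | move=> p q].
  rewrite coproduct23_tens KE mulS2D leg2_counit_tens -scalerAl.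
  by rewrite tensZl tensZr.
rewrite /coaction -K_d2 -coproduct12D K_d1.
move: (D h); apply: tensor_ext; [lin | lin | move=> p q].
rewrite !tlift_tens; try by bil.
by rewrite half_braiding_coproduct -mulrA -half_braiding_right tensM mulr1 mul1r.
Qed.

Local Notation T := (drinfeld (coaction : {linear H -> tensor H H})).

Lemma drinfeldE h : T h = antipode2 h * T 1.
Proof. by rewrite -(drinfeld_mul coaction_mul) mulr1. Qed.

(** Contract the value [J * (g (x) 1)] of the half-braiding at [J] by
    [a (x) b |-> S(a) b]. *)
Lemma drinfeld1 : S Q * T 1 = S g * Q.
Proof.
have cT Y : mulS1 (c Y) = S (mulS1 Y) * T 1.
  move: Y; apply: tensor_ext; [lin | lin | move=> p q].
  rewrite half_braiding_tens mulS1_mul mulr1 -[mulS1 (coaction p)]/(T p).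
  by rewrite drinfeldE mulS1_tens antipodeM mulrA.
by rewrite -cT half_braiding_twist mulS1_mul mulr1.
Qed.

Lemma twist_antipode_grouplike : S g * Q * g = Q.
Proof.
rewrite -mulS1_mul -g_grouplike mulS1_coproduct twisted_grouplike_counit.
by rewrite scale1r.
Qed.

End Twisted.

(** * Orders of twisted grouplike elements *)

Lemma comm_nilpotentB (A : nzRingType) (a b : A) i j : GRing.comm a b ->
  a ^+ i = 0 -> b ^+ j = 0 -> (a - b) ^+ (i + j) = 0.
Proof.
move=> ab a0 b0; rewrite exprDn_comm; last exact: commrN.
apply: big1 => k _; suff -> : a ^+ (i + j - k) * (- b) ^+ k = 0 by rewrite mul0rn.
have [jk|/ltnW kj] := leqP j k.
  by rewrite exprNn -(subnKC jk) (exprD b) b0 mul0r !mulr0.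
by rewrite -addnBA // exprD a0 !mul0r.
Qed.

Lemma tensBl (F : fieldType) (U V : vectType F) (a b : U) (v : V) :
  tens (a - b) v = tens a v - tens b v.
Proof. by have := tensPl v (-1) b a; rewrite !scaleN1r ![- _ + _]addrC. Qed.

Lemma tensBr (F : fieldType) (U V : vectType F) (a b : V) (u : U) :
  tens u (a - b) = tens u a - tens u b.
Proof. by have := tensPr u (-1) b a; rewrite !scaleN1r ![- _ + _]addrC. Qed.

Lemma tens_neq0 (F : fieldType) (U : vectType F) (u : U) :
  u != 0 -> tens u u != 0.
Proof.
move=> u0; apply: contra u0 => /eqP uu0; apply/eqP; rewrite [LHS]vbasis_coord.
apply: big1 => i _; have /eqP := congr1 (lcontr (coord (vbasis {:U}) i)) uu0.
rewrite lcontr_tens ?linear0; last by lin.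
by rewrite scaler_eq0 => /orP[/eqP->|/eqP->]; rewrite ?scale0r // !linear0 scale0r.
Qed.

Lemma iter_mulr_comm (A : nzRingType) (U : A -> A) a :
    (forall x, U (x * a) = U x * a) ->
  forall n x, iter n U (x * a) = iter n U x * a.
Proof. by move=> Ua; elim=> //= n IH x; rewrite IH Ua. Qed.

Lemma iter_mulr (A : nzRingType) (U V : A -> A) a :
    (forall x, U (x * a) = U x * a) -> (forall x, V x = U x * a) ->
  forall n, iter n V 1 = iter n U 1 * a ^+ n.
Proof.
move=> Ua VE; have UaX x k : U (x * a ^+ k) = U x * a ^+ k.
  by elim: k => [|k IH]; rewrite ?expr0 ?mulr1 // exprSr !mulrA Ua IH.
by elim=> [|n IH]; rewrite ?expr0 ?mulr1 //= IH VE UaX exprSr mulrA.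
Qed.

Section TwistedGrouplikes.
Variables (F : numFieldType) (H : hopfAlgebra F).

Local Notation D := (coproduct H).
Local Notation S := (antipode H).

Variable J : tensor H H.
Hypothesis J_unit : J \is a GRing.unit.

Lemma twisted_grouplikeX g n :
  D g * J = J * tens g g -> D (g ^+ n) * J = J * tens (g ^+ n) (g ^+ n).
Proof.
move=> gJ; elim: n => [|n IH]; first by rewrite !expr0 rmorph1 tens11 mul1r mulr1.
by rewrite !exprS coproductM -mulrA IH mulrA gJ -mulrA tensM.
Qed.

(** With [y = v - 1] of nilpotency index [N >= 2], the coproduct sends [y ^+ N]
    to a conjugate of [(y (x) 1 + v (x) y) ^+ N], and the product of this power
    with [1 (x) y ^+ (N - 2)] is [N] times [y ^+ (N - 1) (x) y ^+ (N - 1)]. *)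
Lemma unipotent_twisted_grouplike v k :
  D v * J = J * tens v v -> (v - 1) ^+ k = 0 -> v = 1.
Proof.
move=> vJ vk; apply/eqP; rewrite -subr_eq0; apply/negPn/negP => y0.
set y := v - 1 in vk y0.
have [] := @ex_minnP (fun n => y ^+ n == 0); first by exists k; apply/eqP.
case=> [|[|n]]; rewrite ?expr0 ?oner_eq0 ?expr1 ?(negPf y0) // => /eqP yN minN.
have yn0 : y ^+ n.+1 != 0 by apply: contraT => /negPn/minN; rewrite ltnn.
have vE : v = 1 + y by rewrite addrC subrK.
have vy : GRing.comm v y by rewrite vE; apply: commr_sym; apply: commrD; [exact: commr1 | by []].
pose A : tensor H H := tens y 1; pose B : tensor H H := tens v y.
have yJ : D y * J = J * (A + B).
  rewrite linearB /= rmorph1 mulrBl mul1r vJ -{2}[J]mulr1 -mulrBr; congr (_ * _).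
  by rewrite /A /B /y tensBl tensBr tens11 [RHS]addrC addrA subrK.
have AB : GRing.comm A B by rewrite /GRing.comm !tensM !mul1r !mulr1 vy.
have yJX i : D (y ^+ i) * J = J * (A + B) ^+ i.
  elim: i => [|i IH]; first by rewrite !expr0 rmorph1 mul1r mulr1.
  by rewrite !exprS coproductM -mulrA IH [LHS]mulrA yJ -[LHS]mulrA.
have ABN : (A + B) ^+ n.+2 = 0.
  by apply: (can_inj (mulKr J_unit)); rewrite -yJX yN linear0 mul0r mulr0.
have tensX a b i : tens (a : H) (b : H) ^+ i = tens (a ^+ i) (b ^+ i).
  by elim: i => // i IH; rewrite !exprS IH tensM.
have := congr1 (fun X => X * tens 1 (y ^+ n)) ABN.
rewrite mul0r exprDn_comm // mulr_suml big_ord_recl big_ord_recl.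
rewrite big1 ?addr0 => [|i _].
  rewrite subn0 {1}/A tensX yN -[tens 0 _]/(tens (0 : H) _).
  have t0 : tens (0 : H) ((1 : H) ^+ n.+2) = 0 by rewrite -(subrr (0 : H)) tensBl subrr.
  rewrite t0 !mul0r add0r lift0 /= subSS subn0 expr1 bin1 mulrnAl.
  rewrite tensX expr1n !tensM mul1r mulr1 -exprS.
  have -> : y ^+ n.+1 * v = y ^+ n.+1.
    by rewrite vE mulrDr mulr1 -exprSr yN addr0.
  rewrite -scaler_nat => /eqP; rewrite scaler_eq0 pnatr_eq0 /=.
  by rewrite (negPf (tens_neq0 yn0)).
rewrite !lift0 mulrnAl -mulrA /B.
rewrite (tensX v) tensM -exprD; suff -> : y ^+ (i.+2 + n) = 0.
  have -> : forall a : H, tens a (0 : H) = 0.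
    by move=> a; rewrite -(subrr (0 : H)) tensBr subrr.
  by rewrite mulr0 mul0rn.
by rewrite -[in RHS](mul0r (y ^+ i)) -yN -exprD addSn addSn addnC !addSn.
Qed.

Hypothesis J_cocycle :
  coproduct12 J * embed12 J = coproduct23 J * embed23 J.
Hypothesis J_counit1 : leg1_counit J = 1.
Hypothesis J_counit2 : leg2_counit J = 1.

Variables (G X : H -> Prop) (l : nat).
Hypothesis l_gt0 : (0 < l)%N.
Hypothesis G_grouplike : forall x, G x -> D x = tens x x.
Hypothesis G_comm : forall x y, G x -> G y -> GRing.comm x y.
Hypothesis G_order : forall x, G x -> x ^+ l = 1.
Hypothesis X_primitive : forall x, X x ->
  exists a b, [/\ G a, G b & D x = tens x a + tens b x].
Hypothesis word_span : exists N, forall phi, linear phi -> kills G X N phi ->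
  forall h, phi h = 0.
Hypothesis antipode_order : forall h, iter l (@antipode2 F H) h = h.

Local Notation Q := (twist_antipode J).
Local Notation T g := (drinfeld (coaction J g : {linear H -> tensor H H})).

Lemma twisted_drinfeld_power_unipotent g :
  g != 0 -> D g * J = J * tens g g -> exists k, (iter l (T g) 1 - 1) ^+ k = 0.
Proof.
move=> g0 gJ.
apply: (@drinfeld_power_unipotent F H G X l l_gt0 G_grouplike G_comm G_order
  X_primitive word_span (coaction J g : {linear H -> tensor H H})) => //.
- exact: coaction_counit gJ.
- exact: coactionA.
- exact: coaction_mul.
Qed.

(** The inverse [g'] of [g] satisfies [T_g = T_1 g'], so that [Z_g] is
    [Z_1 * g' ^+ l]. *)
Theorem twisted_grouplike_order g :
  g != 0 -> D g * J = J * tens g g -> g ^+ l = 1.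
Proof.
move=> g0 gJ; have Q_unit : Q \is a GRing.unit by exact: twist_antipode_unit.
have oneJ : D 1 * J = J * tens 1 1 by rewrite rmorph1 tens11 mul1r mulr1.
pose g' := Q^-1 * S g * Q; pose t := T 1 1.
have Sg_Q : S g * Q = Q * g' by rewrite !mulrA mulrV // mul1r.
have g'g : g' * g = 1.
  by apply: (can_inj (mulKr Q_unit)); rewrite mulrA -Sg_Q mulr1;
    exact: twist_antipode_grouplike.
have gg' : g * g' = 1 by exact: falg_inverseC.
have SQ_inj : injective ( *%R (S Q)).
  by apply: (can_inj (g := *%R (S Q^-1))) => z; rewrite mulrA -antipodeM mulrV //
    antipode1 mul1r.
have SQt : S Q * t = Q by rewrite drinfeld1 // ?oner_neq0 // antipode1 mul1r.
have Tg1 : T g 1 = t * g'.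
  by apply: SQ_inj; rewrite drinfeld1 // mulrA SQt.
have Sg'_Q : S g' * Q = Q * g.
  rewrite -[LHS]mulr1 -g'g mulrA -[S g' * Q * g']mulrA -Sg_Q !mulrA -antipodeM.
  by rewrite gg' antipode1 mul1r.
have S2g' : antipode2 g' * t = t * g'.
  apply: SQ_inj; rewrite mulrA -antipodeM Sg'_Q antipodeM -mulrA SQt.
  by rewrite mulrA SQt.
have T1E h : T 1 h = antipode2 h * t by exact: drinfeldE.
have TgE h : T g h = T 1 h * g'.
  by rewrite T1E -mulrA -Tg1; exact: drinfeldE.
have T1g' h : T 1 (h * g') = T 1 h * g'.
  by rewrite !T1E antipode2M -!mulrA S2g'.
have iterT1g' h n : iter n (T 1) (h * g') = iter n (T 1) h * g'.
  exact: iter_mulr_comm T1g' n h.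
have iterTg n : iter n (T g) 1 = iter n (T 1) 1 * g' ^+ n.
  exact: iter_mulr T1g' TgE n.
have [i Zi] := twisted_drinfeld_power_unipotent (oner_neq0 H) oneJ.
have [j Zj] := twisted_drinfeld_power_unipotent g0 gJ.
set Z := iter l (T 1) 1 in Zi; rewrite iterTg -/Z in Zj.
have Zg' : GRing.comm Z g'.
  rewrite /GRing.comm -iterT1g' mul1r.
  rewrite (iter_drinfeld (coaction_mul J_unit J_cocycle J_counit1 J_counit2 1)).
  by rewrite antipode_order.
have g'J : D g' * J = J * tens g' g'.
  rewrite -[LHS]mulr1 -tens11 -gg' -tensM mulrA -[_ * J * _]mulrA -gJ mulrA -coproductM.
  by rewrite g'g rmorph1 mul1r.
have g'l : g' ^+ l = 1.
  apply: (unipotent_twisted_grouplike (k := j + i) (twisted_grouplikeX l g'J)).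
  have -> : g' ^+ l - 1 = (Z * g' ^+ l - 1) - (Z - 1) * g' ^+ l.
    by rewrite mulrBl mul1r opprB [RHS]addrC addrA subrK.
  have Zg'l : GRing.comm Z (g' ^+ l) by exact: commrX.
  have ZZ : GRing.comm (Z - 1) (g' ^+ l).
    by apply/commr_sym/commrB; [exact: commr_sym | exact: commr1].
  apply: comm_nilpotentB => //.
    apply: commrM; apply/commr_sym/commrB; try exact: commr1.
    - by apply/commrM/ZZ; apply/commr_sym/commrB; [|exact: commr1].
    - by apply: commrM; [exact: commr_sym|].
  by rewrite exprMn_comm // Zi mul0r.
by rewrite -[LHS]mulr1 -g'l -exprMn_comm ?gg' ?expr1n // /GRing.comm gg' g'g.
Qed.

End TwistedGrouplikes.

(** * The quantum group *)

Lemma kernel_vspace (F : fieldType) (V W : vectType F) (f : V -> W) :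
  linear f -> exists M : {vspace V}, forall v, (v \in M) = (f v == 0).
Proof.
move=> lf; pose f' : {linear V -> W} := HB.pack f (GRing.isLinear.Build F _ _ *:%R f lf).
by exists (lker (linfun f')) => v; rewrite memv_ker lfunE.
Qed.

Section Naturality.
Variables (F : fieldType) (n : nat) (A : 'M[int]_n) (d : 'I_n -> nat) (q : F).
Variables (l : nat) (w0 : seq 'I_n).
Variables (B B' : algType F) (f : {lrmorphism B -> B'}).

Lemma eq_gensP (C : Type) (x y : uq_gens n C) : eq_gens x y -> x = y.
Proof.
case: x y => [xe xf xK xL] [ye yf yK yL] [] /= He Hf HK HL.
by rewrite (funext He) (funext Hf) (funext HK) (funext HL).
Qed.

Lemma map_Kpow (y : uq_gens n B) i z : Kpow (map_gens f y) i z = f (Kpow y i z).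
Proof. by rewrite /Kpow; case: ifP => _; rewrite rmorphXn. Qed.

Lemma map_braid (y : uq_gens n B) i :
  braid A d q (map_gens f y) i = map_gens f (braid A d q y i).
Proof.
apply: eq_gensP; split=> j /=; rewrite ?map_Kpow ?rmorphM //=.
- case: ifP => _; first by rewrite rmorphN rmorphM.
  rewrite rmorph_sum /=; apply: eq_bigr => k _.
  by rewrite linearZ /= !rmorphM /= !rmorphXn.
- case: ifP => _; first by rewrite rmorphN rmorphM.
  rewrite rmorph_sum /=; apply: eq_bigr => k _.
  by rewrite linearZ /= !rmorphM /= !rmorphXn.
Qed.

Lemma map_braid_word (y : uq_gens n B) w :
  braid_word A d q (map_gens f y) w = map_gens f (braid_word A d q y w).
Proof. by elim: w y => //= i w IH y; rewrite map_braid IH. Qed.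

Lemma map_serre (u : 'I_n -> B) i j :
  serre_sum A d q (f \o u) i j = f (serre_sum A d q u i j).
Proof.
rewrite rmorph_sum /=; apply: eq_bigr => k _.
by rewrite linearZ /= !rmorphM /= !rmorphXn.
Qed.

Lemma uq_relations_reflect (y : uq_gens n B) : injective f ->
  uq_relations A d q l w0 (map_gens f y) -> uq_relations A d q l w0 y.
Proof.
move=> f_inj [[r1 r2 r3 r4 r5 r6 r7 r8] [s1 s2]].
split; first split.
- by move=> i; apply: f_inj; rewrite rmorphM rmorph1; exact: r1.
- by move=> i; apply: f_inj; rewrite rmorphM rmorph1; exact: r2.
- by move=> i j; apply: f_inj; rewrite !rmorphM; exact: r3.
- by move=> i j; apply: f_inj; rewrite linearZ !rmorphM; exact: r4.
- by move=> i j; apply: f_inj; rewrite linearZ !rmorphM; exact: r5.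
- move=> i j; apply: f_inj; rewrite rmorphB !rmorphM; have := r6 i j => /= ->.
  by case: ifP => _; rewrite ?rmorph0 // linearZ rmorphB.
- by move=> i j /r7; rewrite map_serre => fz; apply: f_inj; rewrite fz rmorph0.
- by move=> i j /r8; rewrite map_serre => fz; apply: f_inj; rewrite fz rmorph0.
split=> [i|w i w' wE]; first by apply: f_inj; rewrite rmorphXn rmorph1; exact: s1.
have [] := s2 w i w' wE; rewrite map_braid_word /= => s3 s4.
by split; apply: f_inj; rewrite rmorphXn rmorph0.
Qed.

End Naturality.

Section Generation.
Variables (F : fieldType) (n : nat) (A : 'M[int]_n) (d : 'I_n -> nat) (q : F).
Variables (l : nat) (w0 : seq 'I_n) (B : falgType F) (x : uq_gens n B).
Hypothesis x_presented : uq_presented A d q l w0 x.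

Definition uq_letters : seq B :=
  [seq gen_e x i | i <- enum 'I_n] ++ [seq gen_f x i | i <- enum 'I_n] ++
  [seq gen_K x i | i <- enum 'I_n] ++ [seq gen_Kinv x i | i <- enum 'I_n].

(** The map given by the universal property to the generated subalgebra, followed
    by the inclusion, is an endomorphism that fixes the generators, hence the
    identity. *)
Lemma uq_generated : agenv <<uq_letters>>%VS = fullv.
Proof.
pose C : {aspace B} := agenv_aspace <<uq_letters>>%VS; rewrite -[agenv _]/(asval C).
have lettersC y : y \in uq_letters -> y \in C.
  by move=> yx; apply: (subvP (sub_agenv _)); apply: memv_span.
have C1 : algid C = 1 by apply/eqP; rewrite algid_eq1; exact: (subvP (sub1_agenv _) _ (memv_line 1)).
have mm : monoid_morphism (vsval : subvs_of C -> B) by split.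
pose iota : {lrmorphism subvs_of C -> B} := HB.pack (vsval : subvs_of C -> B)
  (GRing.isLinear.Build F _ _ *:%R (vsval : subvs_of C -> B) (fun _ _ _ => erefl))
  (GRing.isMonoidMorphism.Build _ _ (vsval : subvs_of C -> B) mm).
have iota_inj : injective iota by exact: val_inj.
pose y := map_gens (vsproj C) x.
have yx : map_gens iota y = x.
  apply: eq_gensP; split=> i /=; apply: vsprojK; apply: lettersC;
    rewrite !mem_cat !map_f ?mem_enum ?orbT //.
have [xrel xuniv] := x_presented.
have yrel : uq_relations A d q l w0 y.
  by apply: (uq_relations_reflect (f := iota)) => //; rewrite yx.
have [phi [phiy _]] := xuniv _ y yrel.
have [phi0 [_ phi0_uniq]] := xuniv _ x xrel.
have comp_id : iota \o phi =1 idfun.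
  move=> h; rewrite (phi0_uniq idfun) //.
  apply: phi0_uniq.
  suff -> : map_gens (iota \o phi) x = x by [].
  by rewrite -[RHS]yx -(eq_gensP phiy).
apply/eqP; rewrite eqEsubv subvf; apply/subvP => h _.
by rewrite -[h]comp_id; apply: subvsP.
Qed.

End Generation.

Section QuantumGroup.
Variables (F : fieldType) (n : nat) (A : 'M[int]_n) (d : 'I_n -> nat) (q : F).
Variables (l : nat) (w0 : seq 'I_n) (H : hopfAlgebra F) (x : uq_gens n H).
Hypothesis l_gt0 : (0 < l)%N.

Local Notation D := (coproduct H).
Local Notation S := (antipode H).
Local Notation E := (gen_e x).
Local Notation FF := (gen_f x).
Local Notation K := (gen_K x).
Local Notation L := (gen_Kinv x).

Hypothesis x_presented : uq_presented A d q l w0 x.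
Hypothesis DK : forall i, D (K i) = tens (K i) (K i).
Hypothesis DE : forall i, D (E i) = tens (E i) 1 + tens (K i) (E i).
Hypothesis DF : forall i, D (FF i) = tens (FF i) (L i) + tens 1 (FF i).

Definition uq_grouplike (y : H) : Prop := y = 1 \/ exists i k, y = K i ^+ k.
Definition uq_primitive (y : H) : Prop := exists i, y = E i \/ y = FF i.
Local Notation G := uq_grouplike.
Local Notation X := uq_primitive.

Let KL i : K i * L i = 1. Proof. exact: rel_KKinv x_presented.1.1 i. Qed.
Let LK i : L i * K i = 1. Proof. exact: rel_KinvK x_presented.1.1 i. Qed.
Let Kl i : K i ^+ l = 1. Proof. exact: x_presented.1.2.1. Qed.
Let LE i : L i = K i ^+ l.-1.
Proof. by rewrite -[LHS]mul1r -(Kl i) -{1}(prednK l_gt0) exprSr -mulrA KL mulr1. Qed.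

Lemma uq_grouplikeD y : G y -> D y = tens y y.
Proof.
case=> [->|[i [k ->]]]; first by rewrite rmorph1.
elim: k => [|k IH]; first by rewrite expr0 rmorph1.
by rewrite exprS coproductM IH DK tensM.
Qed.

Lemma uq_grouplike_comm y z : G y -> G z -> GRing.comm y z.
Proof.
case=> [->|[i [k ->]]] [->|[j [m ->]]]; try exact: commr1;
  try exact/commr_sym/commr1.
apply: commrX; apply: commr_sym; apply: commrX.
exact: rel_KK x_presented.1.1 j i.
Qed.

Lemma uq_grouplike_order y : G y -> y ^+ l = 1.
Proof. by case=> [->|[i [k ->]]]; rewrite ?expr1n // exprAC Kl expr1n. Qed.

Lemma uq_primitiveD y : X y ->
  exists a b, [/\ G a, G b & D y = tens y a + tens b y].
Proof.
case=> i [->|->].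
  exists 1, (K i); split; [by left | by right; exists i, 1%N | exact: DE].
exists (L i), 1; split; [by right; exists i, l.-1 | by left | exact: DF].
Qed.

Lemma uq_letters_word y : y \in uq_letters x -> G y \/ X y.
Proof.
rewrite !mem_cat => /or4P[] /mapP[i _ ->].
- by right; exists i; left.
- by right; exists i; right.
- by left; right; exists i, 1%N.
by left; right; exists i, l.-1; exact: LE.
Qed.

(** Each product of [i] generators has degree at most [i], and such products with
    [i] below the dimension span the generated algebra. *)
Lemma uq_word_span : exists N, forall phi, linear phi -> kills G X N phi ->
  forall h, phi h = 0.
Proof.
have step i (phi : H -> F^o) : linear phi -> kills G X i.+1 phi ->
    forall h, h \in (<<uq_letters x>> ^+ i)%VS -> phi h = 0.
  elim: i phi => [|i IH] phi lphi kphi h.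
    rewrite expv0 => /vlineP[k ->]; rewrite linear_scale // (kphi 0%N) ?scaler0 //.
    exact: word1.
  have [M ME] := kernel_vspace lphi.
  suff: (<<uq_letters x>> ^+ i.+1 <= M)%VS by move=> /subvP sub /sub; rewrite ME => /eqP.
  rewrite expvSr; apply/prodvP => u v uU vU; rewrite ME; apply/eqP.
  have lu : linear (fun v => phi (u * v)) by lin.
  have [M' M'E] := kernel_vspace lu.
  suff: (<<uq_letters x>> <= M')%VS by move=> /subvP/(_ _ vU); rewrite M'E => /eqP.
  apply/span_subvP => y /uq_letters_word yGX; rewrite M'E; apply/eqP.
  apply: (IH (fun u => phi (u * y))) => //; first by lin.
  by case: yGX => y0; [apply: (killsW (leqnSn _)); exact: kills_grouplike
                      | exact: kills_primitive].
exists (\dim {:H}) => phi lphi kphi h; have [M ME] := kernel_vspace lphi.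
suff: (agenv <<uq_letters x>> <= M)%VS.
  by rewrite (uq_generated x_presented) => /subvP/(_ h (memvf _)); rewrite ME => /eqP.
apply/subv_sumP => i _; apply/subvP => y yU; rewrite ME; apply/eqP.
by apply: (step i) => //; apply: killsW kphi.
Qed.

Let K_antipode i : S (K i) = L i /\ S (L i) = K i.
Proof.
have K0 : K i != 0.
  by apply: contra_eq_neq (KL i) => ->; rewrite mul0r eq_sym oner_neq0.
have [SK _ SSK] := grouplike_antipode K0 (DK i).
have SKE : S (K i) = L i by rewrite -[LHS]mulr1 -(KL i) mulrA SK mul1r.
by split=> //; rewrite -SKE.
Qed.

Lemma uq_antipode2_grouplike y : G y -> antipode2 y = y.
Proof.
case=> [->|[i [k ->]]]; first by rewrite /antipode2 !antipode1.
elim: k => [|k IH]; first by rewrite expr0 /antipode2 !antipode1.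
by rewrite exprS antipode2M IH /antipode2 (K_antipode i).1 (K_antipode i).2.
Qed.

Lemma uq_antipode2_primitive y : X y ->
  exists i, antipode2 y = L i * y * K i.
Proof.
have counit0 (c : F) (u : H) : u != 0 -> c *: u = 0 -> c = 0.
  by move=> u0 /eqP; rewrite scaler_eq0 (negPf u0) orbF => /eqP.
have unit_neq0 (u v : H) : u * v = 1 -> u != 0.
  by move=> uv; apply: contra_eq_neq uv => ->; rewrite mul0r eq_sym oner_neq0.
case=> i yi; exists i; have [SK SL] := K_antipode i; case: yi => ->.
  have eE : (counit H (E i) : F) = 0.
    apply: (counit0 _ (K i) (unit_neq0 _ _ (KL i))).
    have /eqP := leg2_counitD (E i); rewrite DE linearD /= !leg2_counit_tens.
    by rewrite rmorph1 scale1r addrC -subr_eq0 addrK => /eqP.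
  have /eqP := mulS1D (E i); rewrite DE linearD /= !mulS1_tens eE scale0r mulr1 SK.
  rewrite addr_eq0 => /eqP SE.
  by rewrite /antipode2 SE linearN /= antipodeM SE SL mulNr opprK.
have eF : (counit H (FF i) : F) = 0.
  apply: (counit0 _ (L i) (unit_neq0 _ _ (LK i))).
  have /eqP := leg1_counitD (FF i); rewrite DF linearD /= !leg1_counit_tens.
  by rewrite rmorph1 scale1r -subr_eq0 addrK => /eqP.
have /eqP := mulS1D (FF i); rewrite DF linearD /= !mulS1_tens eF scale0r antipode1.
rewrite mul1r addr_eq0 => /eqP SF.
have SFE : S (FF i) = - (FF i * K i).
  by rewrite -mulNr -SF -mulrA LK mulr1.
by rewrite /antipode2 SFE linearN /= antipodeM SFE SK mulrN opprK mulrA.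
Qed.

(** [S ^ 2] is conjugation by [K_i^-1] on [e_i] and [f_i], and [K_i ^ l = 1]. *)
Lemma uq_antipode2_order h : iter l (@antipode2 F H) h = h.
Proof.
have iterM m y z : iter m (@antipode2 F H) (y * z)
    = iter m (@antipode2 F H) y * iter m (@antipode2 F H) z.
  by elim: m => //= m ->; rewrite antipode2M.
have iterG m y : G y -> iter m (@antipode2 F H) y = y.
  by move=> Gy; elim: m => //= m ->; exact: uq_antipode2_grouplike.
have iterL m i : iter m (@antipode2 F H) (L i) = L i.
  by apply: iterG; right; exists i, l.-1; exact: LE.
have iterK m i : iter m (@antipode2 F H) (K i) = K i.
  by apply: iterG; right; exists i, 1%N.
have iterX y : X y -> iter l (@antipode2 F H) y = y.
  move=> /uq_antipode2_primitive[i yE].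
  have iE m : iter m (@antipode2 F H) y = L i ^+ m * y * K i ^+ m.
    elim: m => [|m IH]; first by rewrite !expr0 mul1r mulr1.
    by rewrite iterSr yE !iterM IH iterL iterK exprS [K i ^+ m.+1]exprSr !mulrA.
  by rewrite iE Kl mulr1 LE exprAC Kl expr1n mul1r.
have iter_lin : linear (iter l (@antipode2 F H)).
  elim: {iterX}l => [|m IH] k y z //=; rewrite IH /antipode2; by rewrite !linearP.
have iter_word j w : word G X j w -> iter l (@antipode2 F H) w = w.
  elim=> {j w} [|k w y _ IH Gy|k w y _ IH Xy].
  - by apply: iterG; left.
  - by rewrite iterM IH iterG.
  - by rewrite iterM IH iterX.
have [N spanN] := uq_word_span.
apply/eqP; rewrite -subr_eq0; apply/eqP; rewrite [LHS]vbasis_coord.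
apply: big1 => i _.
have := spanN (fun u => coord (vbasis {:H}) i (iter l (@antipode2 F H) u - u)).
move=> -> //; first by rewrite scale0r.
  by move=> k y z; rewrite iter_lin opprD addrACA -scalerBr linearP.
by move=> j w _ /iter_word ->; rewrite subrr linear0.
Qed.

End QuantumGroup.

Theorem corollary4p11 (R : realType)
    (g : lieAlgebra R[i]) (g_semisimple : lie_semisimple g)
    (n : nat) (A : 'M[int]_n) (A_cartan : is_cartan_matrix g A)
    (d : 'I_n -> nat) (d_sym : symmetrizing_integers A d)
    (w0 : seq 'I_n) (w0_longest : longest_word A w0)
    (l : nat) (q : R[i]) (q_prim : l.-primitive_root q)
    (Uq : hopfAlgebra R[i]) (Uq_def : is_uq A d q l w0 Uq)
    (J : tensor Uq Uq) (J_twist : is_twist J)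
    (x : Uq) (x_grouplike : grouplike_twisted J x) :
  exists2 m : nat, has_order x m & (m %| l)%N.
Proof.
have l_gt0 := prim_order_gt0 q_prim.
have [y [y_presented DK DE DF]] := Uq_def.
have [J_unit J_cocycle J_counit1 J_counit2] := J_twist.
have [x0 xJ] := x_grouplike.
have xl : x ^+ l = 1.
  have cocycle : coproduct12 J * embed12 J = coproduct23 J * embed23 J.
    by rewrite /coproduct12 /embed12 -tassoc_mul; exact: J_cocycle.
  apply: (twisted_grouplike_order J_unit cocycle J_counit1 J_counit2 l_gt0
    (uq_grouplikeD DK) (uq_grouplike_comm y_presented)
    (uq_grouplike_order y_presented)
    (uq_primitiveD l_gt0 y_presented DE DF)
    (uq_word_span l_gt0 y_presented)
    (uq_antipode2_order l_gt0 y_presented DK DE DF) x0).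
  by rewrite -xJ /twisted_coproduct !mulrA divrr // mul1r.
have [|m /andP[m_gt0 /eqP xm] m_min] := @ex_minnP (fun m => (0 < m)%N && (x ^+ m == 1)).
  by exists l; rewrite l_gt0 xl eqxx.
exists m; first by split=> // k k0 xk; apply: m_min; rewrite k0 xk eqxx.
rewrite /dvdn; apply: contraT; rewrite -lt0n => lm; have := ltn_pmod l m_gt0.
rewrite ltnNge m_min // lm /=; apply/eqP.
by rewrite -xl {2}(divn_eq l m) exprD mulnC exprM xm expr1n mul1r.
Qed.
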